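(* Let $\mu\ge0$, $\mathcal{G}\in\mathrm{SM}_\mu$, and let there exist $\alpha\in[-1,0)$, constants $C,c>0$ and $\rho_0\ge1$ such that for $k=0,1$ and all $\rho\ge\rho_0$ $$c\rho^{\alpha+1}\int_{\mu/\rho}^{+\infty}\frac{t^{k+\alpha}dt}{t^2+1}\le\int_{\mu/\rho}^{+\infty}\frac{t^k\,\mathcal{G}(\rho\,dt)}{t^2+1}\le C\rho^{\alpha+1}\int_{\mu/\rho}^{+\infty}\frac{t^{k+\alpha}dt}{t^2+1}.$$ Let $X^+$ (resp. $X^-$) be a spectrally positive (resp. spectrally negative) Lévy process with characteristic exponent $\psi_+$ (resp. $\psi_-$) given below, and let $b\in\mathbb{R}$. Then: (a) if $\psi_\pm(\xi)=\xi^2ST(\mathcal{G})(\mp i\xi)\mp ib\xi$ and $\alpha\in(-1,0)$, then $X^\pm$ is SINH-regular of order $(\nu,\nu)$, where $\nu=\alpha+2$, and the interior of the cone $\mathcal{C}_+$ contains $\mathbb{R}\setminus\{0\}$; (b) if $\psi_\pm(\xi)=\xi^2ST(\mathcal{G})(\mp i\xi)\mp ib\xi$ and $\alpha=-1$, then $X^\pm$ is SINH-regular of order $(1,1+)$. The cone $\mathcal{C}_+$ is adjacent to $\mathbb{R}$; for $\psi_+$, $\mathcal{C}_+\subset\{\Im\xi<0\}$, and for $\psi_-$, $\mathcal{C}_+\subset\{\Im\xi>0\}$; (c) if $\psi_\pm(\xi)=\mp i\xi ST(\mathcal{G})(\mp i\xi)$ and $\alpha\in(-1,0)$, then $X^\pm$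 is SINH-regular of order $(\nu,\nu)$, where $\nu=\alpha+1$, and the interior of the cone $\mathcal{C}_+$ contains $\mathbb{R}\setminus\{0\}$; (d) if $\psi_\pm(\xi)=\mp i\xi ST(\mathcal{G})(\mp i\xi)$ and $\alpha=-1$, then $X^\pm$ is SINH-regular of order $(0+,0+)$, and the interior of the cone $\mathcal{C}_+$ contains $\mathbb{R}\setminus\{0\}$.
   Context: Characteristic exponent: $\mathbb{E}[e^{i\xi X_t}]=e^{-t\psi(\xi)}$, $\psi(\xi)=-i\tilde\mu\xi+\psi^0(\xi)$ with $\tilde\mu\in\mathbb{R}$ a drift; analytic continuations are denoted by the same letters. $\mathrm{SM}_0$: non-negative measures $\mathcal{G}$ on $(0,+\infty)$ with $\int(1+t)^{-1}\mathcal{G}(dt)<\infty$; $\mathrm{SM}_\mu$ ($\mu>0$): those supported on $[\mu,+\infty)$; $ST(\mathcal{G})(z)=\int_{(0,+\infty)}(z+t)^{-1}\mathcal{G}(dt)$. $\mathcal{G}(\rho\,dt)$ denotes the measure $A\mapsto\mathcal{G}(\rho A)$. Cones: $\mathcal{C}_{\gamma_-,\gamma_+}=\{e^{i\varphi}\rho:\rho>0,\ \varphi\in(\gamma_-,\gamma_+)\cup(\pi-\gamma_+,\pi-\gamma_-)\}$ for $-\pi/2\le\gamma_-\le0\le\gamma_+\le\pi/2$; $\mathcal{C}_\gamma=\{e^{i\varphi}\rho:\rho>0,\varphi\in(-\gamma,\gamma)\}$. Conventions: $\rho^{0+}:=\ln\rho$, $\rho^{1+}:=\rho\ln\rho$ for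 $\rho>1$; orders $\nu',\nu$ belong to $(0,2]\cup\{0+,1+\}$. $X$ is SINH-regular of type $((\mu_-,\mu_+);\mathcal{C};\mathcal{C}_+)$ and order $(\nu',\nu)$ if: $\mu_-<0\le\mu_+$ or $\mu_-\le0<\mu_+$; $\mathcal{C}=\mathcal{C}_{\gamma_-,\gamma_+}$, $\mathcal{C}_+=\mathcal{C}_{\gamma'_-,\gamma'_+}$ with $\gamma_-<0<\gamma_+$, $\gamma_-\le\gamma'_-\le0\le\gamma'_+\le\gamma_+$, $|\gamma'_-|+\gamma'_+>0$; $\psi^0$ admits analytic continuation to $i(\mu_-,\mu_+)+(\mathcal{C}\cup\{0\})$; for all $\gamma_{1,-}\in(\gamma_-,0)$, $\gamma_{1,+}\in(0,\gamma_+)$ there exist $C,R>0$ with $|\psi(\rho e^{i\varphi})|\le C\rho^\nu$ for $\varphi\in[\gamma_{1,-},\gamma_{1,+}]$, $\rho>R$; and for every $[\gamma'_{1,-},\gamma'_{1,+}]\subset(\gamma'_-,\gamma'_+)$ there exist $c,R>0$ with $\Re\psi(\rho e^{i\varphi})\ge c\rho^{\nu'}$ for $\varphi\in[\gamma'_{1,-},\gamma'_{1,+}]$, $\rho>R$. For spectrally positive (resp. negative) processes the domain of analyticity is wider: the strip is $\{\Im\xi>\mu_-\}$, $\mu_-\le0$, and $\mathcal{C}=i\mathcal{C}_\gamma$, $\gamma\in(\pi/2,\pi)$ (resp. the strip is $\{\Im\xi<\mu_+\}$, $\mu_+\ge0$, and $\mathcal{C}=-i\mathcal{C}_\gamma$).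 ''Order $(\nu',\nu)$'' in the claim means that the definition is satisfied with some such cones; ''the interior of $\mathcal{C}_+$ contains $\mathbb{R}\setminus\{0\}$'' means $\gamma'_-<0<\gamma'_+$; ''adjacent to $\mathbb{R}$'' means that $\gamma'_-=0<\gamma'_+$ or $\gamma'_-<0=\gamma'_+$. *)

(* Defs.v *)
From HB Require Import structures.
From mathcomp Require Import all_boot all_order all_algebra.
From mathcomp Require Import all_classical all_reals all_analysis.
From mathcomp Require Import complex.

Set Implicit Arguments.
Unset Strict Implicit.
Unset Printing Implicit Defensive.

Import Order.TTheory GRing.Theory Num.Theory.
Import numFieldNormedType.Exports.

Local Open Scope classical_set_scope.
Local Open Scope ring_scope.
Local Open Scope complex_scope.

Inductive side := Positive | Negative.

Section ComplexPlane.
Context {R : realType}.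
Implicit Types (z : R[i]) (D : set R[i]).

Definition polar (rho phi : R) : R[i] := (rho * cos phi) +i* (rho * sin phi).

Definition cexp z : R[i] := polar (expR (complex.Re z)) (complex.Im z).

(* On an open set D, complex differentiability at every point of D. *)
Definition holomorphic_on D (F : R[i] -> R[i]) : Prop :=
  forall z, D z -> derivable (F : R[i]^o -> R[i]^o) z 1.

Definition continuation_to D (f : R -> R[i]) (F : R[i] -> R[i]) : Prop :=
  holomorphic_on D F /\ (forall xi : R, D xi%:C -> F xi%:C = f xi).

Definition double_cone (gm gp : R) : set R[i] :=
  [set z | exists rho phi : R, [/\ 0 < rho,
     gm < phi < gp \/ pi - gp < phi < pi - gm & z = polar rho phi]].

Definition cone (g : R) : set R[i] :=
  [set z | exists rho phi : R, [/\ 0 < rho, - g < phi < g & z = polar rho phi]].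

Definition sg (s : side) : R := if s is Positive then 1 else -1.

End ComplexPlane.

Section Stieltjes.
Context {R : realType}.
Implicit Types G : {measure set R -> \bar R}.

(* A measure on (0, +oo) is a Borel measure on R that does not charge ]-oo, 0]. *)
Definition SM (mu : R) G : Prop :=
  [/\ G `]-oo, 0]%classic = 0%E, G `]-oo, mu[%classic = 0%E
    & (\int[G]_(t in `]0%R, +oo[) ((1 + t)^-1)%:E < +oo)%E].

Definition ST G (z : R[i]) : R[i] :=
  (\int[G]_(t in `]0, +oo[) complex.Re ((z + t%:C)^-1)) +i*
  (\int[G]_(t in `]0, +oo[) complex.Im ((z + t%:C)^-1)).

(* G(rho dt), i.e. A |-> G (rho A) *)
Definition rescale (rho : R) G : set R -> \bar R :=
  pushforward G (fun t : R => t / rho).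

End Stieltjes.

Section LevyProcesses.
Context {R : realType} {d : measure_display} {Omega : measurableType d}.
Context {P : probability Omega R}.
(* Only the values of X at nonnegative times are relevant. *)
Implicit Type X : R -> {RV P >-> R}.

Definition increment X (s t : R) (w : Omega) : R := X t w - X s w.

Definition independent_increments X : Prop :=
  forall (n : nat) (t : nat -> R) (B : nat -> set R),
    0 <= t 0%N -> (forall k, t k <= t k.+1) -> (forall k, measurable (B k)) ->
    P (\bigcap_(k < n) (increment X (t k) (t k.+1) @^-1` B k)) =
    (\prod_(k < n) P (increment X (t k) (t k.+1) @^-1` B k))%E.

Definition stationary_increments X : Prop :=
  forall (s h : R) (B : set R), 0 <= s -> 0 <= h -> measurable B ->
    P (increment X s (s + h) @^-1` B) = P (increment X 0 h @^-1` B).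

Definition stochastically_continuous X : Prop :=
  forall t e : R, 0 <= t -> 0 < e ->
    P [set w | e < `|increment X t s w|]
      @[s --> within [set s | 0 <= s] (nbhs t)] --> 0%E.

Definition cadlag (x : R -> R) : Prop :=
  (forall t, 0 <= t -> x s @[s --> t^'+] --> x t) /\
  (forall t, 0 < t -> cvg (x s @[s --> t^'-])).

Definition levy_process X : Prop :=
  [/\ {ae P, forall w, X 0 w = 0},
      independent_increments X, stationary_increments X,
      stochastically_continuous X
    & {ae P, forall w, cadlag (fun t => X t w)}].

(* A spectrally positive (negative) process has no negative (positive) jumps;
   processes with monotone paths are not excluded. *)
Definition spectrally (e : side) X : Prop :=
  {ae P, forall w, forall t, 0 < t ->
     0 <= sg e * (X t w - lim (X s w @[s --> t^'-]))}.

Definition characteristic_function (Y : {RV P >-> R}) (xi : R) : R[i] :=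
  fine ('E_P[fun w => cos (xi * Y w)]) +i* fine ('E_P[fun w => sin (xi * Y w)]).

Definition characteristic_exponent X (psi : R -> R[i]) : Prop :=
  forall t xi : R, 0 <= t ->
    characteristic_function (X t) xi = cexp (- t%:C * psi xi).

End LevyProcesses.

Section SinhRegular.
Context {R : realType}.

(* The orders are the elements of (0, 2] and the symbols 0+ and 1+. *)
Inductive sinh_order := Power of R | ZeroPlus | OnePlus.

Definition order_ok (nu : sinh_order) : Prop :=
  if nu is Power a then 0 < a <= 2 else True.

Definition order_pow (rho : R) (nu : sinh_order) : R :=
  match nu with
  | Power a => rho `^ a
  | ZeroPlus => ln rho
  | OnePlus => rho * ln rho
  end.

(* [TwoSided mum mup gm gp] is i(mum, mup) with the cone C_{gm, gp};
   [OneSided Positive m g] is {Im > m} with the cone i C_g, and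
   [OneSided Negative m g] is {Im < m} with the cone - i C_g. *)
Inductive sinh_domain :=
  | TwoSided of R & R & R & R
  | OneSided of side & R & R.

Definition dom_ok (D : sinh_domain) : Prop :=
  match D with
  | TwoSided mum mup gm gp =>
      (mum < 0 <= mup \/ mum <= 0 < mup) /\
      [/\ - (pi / 2) <= gm, gm < 0, 0 < gp & gp <= pi / 2]
  | OneSided Positive m g => m <= 0 /\ pi / 2 < g < pi
  | OneSided Negative m g => 0 <= m /\ pi / 2 < g < pi
  end.

Definition dom_strip (D : sinh_domain) : set R :=
  match D with
  | TwoSided mum mup _ _ => `]mum, mup[%classic
  | OneSided Positive m _ => `]m, +oo[%classic
  | OneSided Negative m _ => `]-oo, m[%classic
  end.

Definition dom_cone (D : sinh_domain) : set R[i] :=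
  match D with
  | TwoSided _ _ gm gp => double_cone gm gp
  | OneSided e _ g => [set (sg e)%:C * 'i * z | z in cone g]
  end.

(* The arguments of the points of the cone: for a one-sided domain, all of them;
   for a two-sided one, those of its component containing (0, +oo). *)
Definition dom_args (D : sinh_domain) : R * R :=
  match D with
  | TwoSided _ _ gm gp => (gm, gp)
  | OneSided e _ g => (sg e * (pi / 2) - g, sg e * (pi / 2) + g)
  end.

Definition dom_set (D : sinh_domain) : set R[i] :=
  [set 'i * y%:C + z | y in dom_strip D & z in dom_cone D `|` [set 0]].

Context {d : measure_display} {Omega : measurableType d}.
Context {P : probability Omega R}.

(* The type is given by D and by the cone C_+ = C_{gm, gp}; Psi is the
   continuation of the characteristic exponent. *)
Definition SINH_regular (X : R -> {RV P >-> R}) (D : sinh_domain) (gm gp : R)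
    (nu' nu : sinh_order) : Prop :=
  let: (am, ap) := dom_args D in
  [/\ dom_ok D,
      order_ok nu' /\ order_ok nu,
      [/\ - (pi / 2) <= gm <= 0, 0 <= gp <= pi / 2, am <= gm, gp <= ap
        & 0 < `|gm| + gp]
    & exists (psi psi0 : R -> R[i]) (drift : R) (Psi0 : R[i] -> R[i]),
      let Psi z := - 'i * drift%:C * z + Psi0 z in
      [/\ characteristic_exponent X psi,
          forall xi, psi xi = - 'i * drift%:C * xi%:C + psi0 xi,
          continuation_to (dom_set D) psi0 Psi0,
          forall a b, am < a < 0 -> 0 < b < ap ->
            exists C r : R, [/\ 0 < C, 0 < r &
              forall rho phi, r < rho -> a <= phi <= b ->
                complex.Re `|Psi (polar rho phi)| <= C * order_pow rho nu]
        & forall a b, gm < a -> a <= b -> b < gp ->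
            exists c r : R, [/\ 0 < c, 0 < r &
              forall rho phi, r < rho -> a <= phi <= b ->
                c * order_pow rho nu' <= complex.Re (Psi (polar rho phi))]]].

End SinhRegular.

(* Main.v *)
(* Put zeta = -+ i xi.  The rotation xi |-> zeta sends the half-plane enlarged
   by the cone +- i C_g into the plane slit along ]-oo, 0], where ST G is
   holomorphic, so the formulas defining psi are their own continuation.  For
   zeta = rho e^(i theta) the kernel 1 / (zeta + t) is compared with the moments
     I_0 = \int rho^2 / (t^2 + rho^2) G(dt),
     I_1 = \int t rho / (t^2 + rho^2) G(dt),
   which are the integrals bounded by the hypothesis: both are of order
   rho^(alpha + 1) if -1 < alpha, while for alpha = -1 (which forces 0 < mu) I_0
   is of order ln rho and I_1 is bounded.  Off the negative half-line,
   |ST G zeta| <= K (I_0 + I_1) / rho, which gives the upper bounds.  With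
   s = cos theta = +- sin (arg xi), small near the real axis,
     Re (xi^2 ST G zeta) >= rho (I_1 / 4 - 2 |s| I_0),
     Re (zeta ST G zeta) >= I_0 / 2 - 2 |s| I_1,
   which gives the lower bounds in (a), (c) and (d).  In (b) the first bound is
   useless since I_1 << I_0, but where s < 0 the I_0-term has the good sign and
   Re (xi^2 ST G zeta) >= rho |s| I_0 absorbs the drift. *)

Require Import Defs.
From HB Require Import structures.
From mathcomp Require Import all_boot all_order all_algebra.
From mathcomp Require Import all_classical all_reals all_analysis.
From mathcomp Require Import measurable_realfun complex.
From mathcomp Require Import ring lra.

Set Implicit Arguments.
Unset Strict Implicit.
Unset Printing Implicit Defensive.

Import Order.TTheory GRing.Theory Num.Theory.
Import numFieldNormedType.Exports.

Local Open Scope classical_set_scope.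
Local Open Scope ring_scope.
Local Open Scope complex_scope.

Import Normc.

(** * Complex arithmetic *)

Section ComplexNorm.
Context {R : realType}.
Implicit Types z w : R[i].

Lemma cReD z w : complex.Re (z + w) = complex.Re z + complex.Re w.
Proof. by case: z w => ? ? []. Qed.

Lemma cImD z w : complex.Im (z + w) = complex.Im z + complex.Im w.
Proof. by case: z w => ? ? []. Qed.

Lemma cReN z : complex.Re (- z) = - complex.Re z.
Proof. by case: z. Qed.

Lemma cImN z : complex.Im (- z) = - complex.Im z.
Proof. by case: z. Qed.

Lemma cReM z w : complex.Re (z * w) =
  complex.Re z * complex.Re w - complex.Im z * complex.Im w.
Proof. by case: z w => ? ? []. Qed.

Lemma cImM z w : complex.Im (z * w) =
  complex.Re z * complex.Im w + complex.Im z * complex.Re w.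
Proof. by case: z w => ? ? []. Qed.

Lemma cReV z : complex.Re z^-1 =
  complex.Re z / (complex.Re z ^+ 2 + complex.Im z ^+ 2).
Proof. by case: z. Qed.

Lemma cImV z : complex.Im z^-1 =
  - (complex.Im z / (complex.Re z ^+ 2 + complex.Im z ^+ 2)).
Proof. by case: z. Qed.

Definition ReImE := (cReD, cImD, cReN, cImN, cReM, cImM, cReV, cImV).

Lemma complex_normE z : `|z| = (normc z)%:C.
Proof. by case: z. Qed.

Lemma normc_ge0 z : 0 <= normc z.
Proof. by case: z => a b; exact: sqrtr_ge0. Qed.

Lemma normcE z : normc z = Num.sqrt (complex.Re z ^+ 2 + complex.Im z ^+ 2).
Proof. by case: z. Qed.

Lemma sqr_normcE z : normc z ^+ 2 = complex.Re z ^+ 2 + complex.Im z ^+ 2.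
Proof. by rewrite normcE sqr_sqrtr// addr_ge0// sqr_ge0. Qed.

Lemma Re_le_normc z : `|complex.Re z| <= normc z.
Proof.
by rewrite -(@ler_pXn2r _ 2) ?nnegrE ?normc_ge0// sqr_normcE
  real_normK ?num_real// lerDl sqr_ge0.
Qed.

Lemma Im_le_normc z : `|complex.Im z| <= normc z.
Proof.
by rewrite -(@ler_pXn2r _ 2) ?nnegrE ?normc_ge0// sqr_normcE
  real_normK ?num_real// lerDr sqr_ge0.
Qed.

Lemma normc_leD z w : normc (z + w) <= normc z + normc w.
Proof. exact: le_normcD. Qed.

Lemma normc_le_ReIm z : normc z <= `|complex.Re z| + `|complex.Im z|.
Proof.
rewrite -(@ler_pXn2r _ 2) ?nnegrE ?normc_ge0 ?addr_ge0// sqr_normcE.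
rewrite sqrrD !real_normK ?num_real// lerD2r lerDl mulrn_wge0 ?mulr_ge0//.
Qed.

(** A second-order remainder makes the difference quotient approach [L] at rate [K * normc h]. The
    estimate is phrased with the real-valued [normc], the form in which integral bounds deliver
    it. *)
Lemma derivable_of_quadratic (F : R[i] -> R[i]) z (L : R[i]) (K r : R) : 0 < r ->
  (forall h, normc h < r ->
     normc (F (z + h) - F z - h * L) <= K * normc h ^+ 2) ->
  derivable (F : R[i]^o -> R[i]^o) z 1.
Proof.
(* The radius [eps] lives in [R[i]]; being positive there, it has zero imaginary part, and [e0] is
   its real value. *)
move=> r0 H; apply/cvg_ex; exists L; apply/cvgrPdist_lt => /= eps eps0.
have [e0 [e00 ee]] : exists e0 : R, 0 < e0 /\ e0%:C = eps.
  exists (complex.Re eps); move: eps0; case: eps => a b.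
  by rewrite ltcE /= => /andP[/eqP -> ->].
have N0 : \forall h \near (0 : (R[i] : numFieldType))^', h != 0 by exact: nbhs_dnbhs_neq.
have N1 (u : R) : 0 < u -> \forall h \near (0 : (R[i] : numFieldType))^', normc h < u.
  move=> u0; have : \forall h \near (0 : (R[i] : numFieldType))^', `|h| < u%:C.
    by apply: dnbhs0_lt; rewrite ltcR.
  by apply: filterS => h; rewrite complex_normE ltcR.
have N2 := N1 _ r0.
(* [K] may be zero or negative, so the radius is divided by [|K| + 1]. *)
have N3 := N1 (e0 / (`|K| + 1)) (divr_gt0 e00 (ltr_wpDl (normr_ge0 _) ltr01)).
near=> h.
have h0 : h != 0 by near: h.
have hr : normc h < r by near: h.
have hK : (`|K| + 1) * normc h < e0.
  rewrite mulrC -ltr_pdivlMr ?ltr_wpDl//; by near: h.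
have nh : 0 < normc h.
  rewrite lt_def normc_ge0 andbT; apply/eqP => /eq0_normc h0'.
  by rewrite h0' eqxx in h0.
have alg (A : R[i]) : L - h^-1 * A = - (h^-1 * (A - h * L)).
  by rewrite mulrBr mulrA mulVf// mul1r opprB.
have -> : L - h^-1 *: (((F \o shift z) (h *: (1 : R[i]^o)) : R[i]^o) - F z) =
    - (h^-1 * (F (z + h) - F z - h * L)) :> R[i].
  rewrite -alg; congr (_ - _ * (F _ - _)).
  by rewrite /= (addrC z); congr (_ + _); exact: mulr1.
rewrite normrN complex_normE -ee ltcR normcM normcV.
apply: le_lt_trans (_ : (normc h)^-1 * (K * normc h ^+ 2) < _).
  by rewrite ler_pM2l ?invr_gt0//; exact: H.
have -> : (normc h)^-1 * (K * normc h ^+ 2) = K * normc h.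
  by field; rewrite gt_eqF.
apply: le_lt_trans hK; rewrite ler_pM2r//.
by apply: le_trans (ler_norm _) _; rewrite lerDl.
Unshelve. all: by end_near. Qed.

End ComplexNorm.

(** On nonnegative reals the inverse is the power of exponent [-1]; at [0] both take the value
    [0]. *)
Lemma measurable_inv_nonneg {R : realType} (D : set R) (f : R -> R) :
  (forall t, 0 <= f t) -> measurable_fun D f -> measurable_fun D (fun t => (f t)^-1).
Proof.
move=> f0 mf; have -> : (fun t => (f t)^-1) = (fun x => x `^ (-1)) \o f.
  by apply/funext => t /=; rewrite powR_inv1.
exact: measurableT_comp (measurable_powR _) mf.
Qed.

(** * Holomorphy of the Stieltjes transform *)

Section StieltjesClass.
Context {R : realType} (G : {measure set R -> \bar R}).
Hypothesis SG : (\int[G]_(t in `]0%R, +oo[) ((1 + t)^-1)%:E < +oo)%E.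
Local Notation D0 := (`]0, +oo[%classic : set R).

Lemma D0P (t : R) : D0 t -> 0 < t.
Proof. by rewrite /= in_itv/= andbT. Qed.

Lemma measurable_D0 : measurable D0.
Proof. exact: measurable_itv. Qed.

Lemma measurable_weight : measurable_fun D0 (fun t : R => (1 + t)^-1).
Proof.
apply: (eq_measurable_fun (fun t : R => (`|1 + t|)^-1)).
  by move=> t /[!inE] /D0P t0; rewrite ger0_norm// addr_ge0// ltW.
apply: measurable_inv_nonneg => //.
apply: (@measurableT_comp _ _ _ _ _ _ (fun x : R => `|x|)) => //.
exact: measurable_funD.
Qed.

Lemma integrable_weight : G.-integrable D0 (EFin \o (fun t : R => (1 + t)^-1)).
Proof.
apply/integrableP; split; first by apply/measurable_EFinP; exact: measurable_weight.
apply: le_lt_trans SG; apply: ge0_le_integral => //.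
- apply: measurableT_comp => //; by apply/measurable_EFinP; exact: measurable_weight.
- by apply/measurable_EFinP; exact: measurable_weight.
- by move=> t /D0P t0 /=; rewrite lee_fin ger0_norm// invr_ge0 addr_ge0// ltW.
Qed.

Lemma integrable_le_weight (f : R -> R) (K : R) : measurable_fun D0 f ->
  (forall t, 0 < t -> `|f t| <= K / (1 + t)) -> G.-integrable D0 (EFin \o f).
Proof.
move=> mf fK.
apply: (@le_integrable _ _ _ _ _ measurable_D0 _ (fun t => (K%:E * ((1 + t)^-1)%:E)%E)).
- exact/measurable_EFinP.
- move=> t /D0P t0 /=; rewrite lee_fin; apply: le_trans (ler_norm _).
  exact: fK.
- exact: (integrableZl measurable_D0 K integrable_weight).
Qed.

Definition wint : R := \int[G]_(t in D0) (1 + t)^-1.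

Lemma Rintegral_le_weight (f : R -> R) (K : R) : measurable_fun D0 f ->
  (forall t, 0 < t -> `|f t| <= K / (1 + t)) ->
  `|\int[G]_(t in D0) f t| <= K * wint.
Proof.
move=> mf fK; have If := integrable_le_weight mf fK.
apply: le_trans (le_normr_Rintegral measurable_D0 If) _.
rewrite /wint -RintegralZl//; last exact: integrable_weight.
apply: le_Rintegral => //; last by move=> t /D0P; exact: fK.
- exact: (integrable_norm If).
- exact: (integrableZl measurable_D0 K integrable_weight).
Qed.

Definition cmeasurable (f : R -> R[i]) :=
  measurable_fun D0 (fun t => complex.Re (f t)) /\
  measurable_fun D0 (fun t => complex.Im (f t)).

Lemma cmeasurable_cst z : cmeasurable (fun=> z).
Proof. by split; exact: measurable_cst. Qed.

Lemma cmeasurable_shift z : cmeasurable (fun t => z + t%:C).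
Proof.
split; [apply: (eq_measurable_fun (fun t => complex.Re z + t))|
        apply: (eq_measurable_fun (fun t => complex.Im z))].
- by move=> t _; rewrite cReD.
- exact: measurable_funD.
- by move=> t _; rewrite cImD /= addr0.
- exact: measurable_cst.
Qed.

Lemma cmeasurableN f : cmeasurable f -> cmeasurable (fun t => - f t).
Proof.
move=> [mr mi]; split.
- apply: (eq_measurable_fun (fun t => - complex.Re (f t))).
    by move=> t _; rewrite cReN.
  exact: measurableT_comp mr.
- apply: (eq_measurable_fun (fun t => - complex.Im (f t))).
    by move=> t _; rewrite cImN.
  exact: measurableT_comp mi.
Qed.

Lemma cmeasurableD f g : cmeasurable f -> cmeasurable g ->
  cmeasurable (fun t => f t + g t).
Proof.
move=> [fr fi] [gr gi]; split.
- apply: (eq_measurable_fun (fun t => complex.Re (f t) + complex.Re (g t))).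
    by move=> t _; rewrite cReD.
  exact: measurable_funD.
- apply: (eq_measurable_fun (fun t => complex.Im (f t) + complex.Im (g t))).
    by move=> t _; rewrite cImD.
  exact: measurable_funD.
Qed.

Lemma cmeasurableM f g : cmeasurable f -> cmeasurable g ->
  cmeasurable (fun t => f t * g t).
Proof.
move=> [fr fi] [gr gi]; split.
- apply: (eq_measurable_fun (fun t => complex.Re (f t) * complex.Re (g t) -
      complex.Im (f t) * complex.Im (g t))).
    by move=> t _; rewrite cReM.
  by apply: measurable_funB; exact: measurable_funM.
- apply: (eq_measurable_fun (fun t => complex.Re (f t) * complex.Im (g t) +
      complex.Im (f t) * complex.Re (g t))).
    by move=> t _; rewrite cImM.
  by apply: measurable_funD; exact: measurable_funM.
Qed.

Lemma cmeasurableV f : cmeasurable f -> cmeasurable (fun t => (f t)^-1).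
Proof.
move=> [fr fi].
have m : measurable_fun D0 (fun t =>
    (complex.Re (f t) ^+ 2 + complex.Im (f t) ^+ 2)^-1).
  apply: measurable_inv_nonneg; first by move=> t; rewrite addr_ge0 ?sqr_ge0.
  by apply: measurable_funD; exact: measurable_funX.
split.
- apply: (eq_measurable_fun (fun t => complex.Re (f t) *
      (complex.Re (f t) ^+ 2 + complex.Im (f t) ^+ 2)^-1)).
    by move=> t _; rewrite cReV.
  exact: measurable_funM.
- apply: (eq_measurable_fun (fun t => - complex.Im (f t) *
      (complex.Re (f t) ^+ 2 + complex.Im (f t) ^+ 2)^-1)).
    by move=> t _; rewrite cImV mulNr.
  by apply: measurable_funM => //; exact: measurableT_comp fi.
Qed.

(** Domination by the weight that defines SM_0: this one predicate supplies the integrability of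
    both components and a bound on the integral. *)
Definition stieltjes_bounded (f : R -> R[i]) (K : R) :=
  cmeasurable f /\ forall t, 0 < t -> normc (f t) <= K / (1 + t).

(** Taken componentwise exactly as in [ST], so that [STE] holds by computation. *)
Definition cintegral (f : R -> R[i]) : R[i] :=
  (\int[G]_(t in D0) complex.Re (f t)) +i* (\int[G]_(t in D0) complex.Im (f t)).

Lemma stieltjes_bounded_Re f K : stieltjes_bounded f K ->
  G.-integrable D0 (EFin \o (fun t => complex.Re (f t))).
Proof.
move=> [[fr fi] fK]; apply: (integrable_le_weight fr) => t t0.
exact: le_trans (Re_le_normc _) (fK t t0).
Qed.

Lemma stieltjes_bounded_Im f K : stieltjes_bounded f K ->
  G.-integrable D0 (EFin \o (fun t => complex.Im (f t))).
Proof.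
move=> [[fr fi] fK]; apply: (integrable_le_weight fi) => t t0.
exact: le_trans (Im_le_normc _) (fK t t0).
Qed.

(** Bounding the two components separately costs the factor 2. *)
Lemma cintegral_le f K : stieltjes_bounded f K ->
  normc (cintegral f) <= (K * wint) *+ 2.
Proof.
move=> [[fr fi] fK]; apply: le_trans (normc_le_ReIm _) _; rewrite mulr2n lerD//=.
- apply: (Rintegral_le_weight fr) => t t0.
  exact: le_trans (Re_le_normc _) (fK t t0).
- apply: (Rintegral_le_weight fi) => t t0.
  exact: le_trans (Im_le_normc _) (fK t t0).
Qed.

Lemma cintegralB f g K L : stieltjes_bounded f K -> stieltjes_bounded g L ->
  cintegral (fun t => f t - g t) = cintegral f - cintegral g.
Proof.
move=> bf bg; apply/eqP; rewrite eq_complex cReD cImD cReN cImN /=.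
under eq_Rintegral do rewrite cReD cReN.
rewrite (RintegralB measurable_D0 (stieltjes_bounded_Re bf) (stieltjes_bounded_Re bg)) eqxx.
under eq_Rintegral do rewrite cImD cImN.
by rewrite (RintegralB measurable_D0 (stieltjes_bounded_Im bf) (stieltjes_bounded_Im bg)) eqxx.
Qed.

Lemma cintegralZ f K u : stieltjes_bounded f K ->
  cintegral (fun t => u * f t) = u * cintegral f.
Proof.
move=> bf; have Ir := stieltjes_bounded_Re bf; have Ii := stieltjes_bounded_Im bf.
have Zl (x : R) h : G.-integrable D0 (EFin \o h) ->
    G.-integrable D0 (EFin \o (fun t => x * h t)).
  by move=> Ih; exact: (integrableZl measurable_D0 x Ih).
apply/eqP; rewrite eq_complex cReM cImM /=.
under eq_Rintegral do rewrite cReM.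
rewrite (RintegralB measurable_D0 (Zl _ _ Ir) (Zl _ _ Ii)).
rewrite (RintegralZl _ measurable_D0 Ir) (RintegralZl _ measurable_D0 Ii) eqxx /=.
under eq_Rintegral do rewrite cImM.
rewrite (RintegralD measurable_D0 (Zl _ _ Ii) (Zl _ _ Ir)).
by rewrite (RintegralZl _ measurable_D0 Ir) (RintegralZl _ measurable_D0 Ii) eqxx.
Qed.

Lemma Re_cintegral_ge f K (h : R -> R) : stieltjes_bounded f K ->
  G.-integrable D0 (EFin \o h) -> (forall t, 0 < t -> h t <= complex.Re (f t)) ->
  \int[G]_(t in D0) h t <= complex.Re (cintegral f).
Proof.
move=> bf Ih hf; apply: (le_Rintegral measurable_D0 Ih (stieltjes_bounded_Re bf)).
by move=> t /D0P; exact: hf.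
Qed.

Definition slit : set R[i] :=
  [set z | complex.Im z != 0 \/ 0 < complex.Re z].

(** Makes the kernel comparable with the weight of SM_0, uniformly in [t]. The proof works with
    squares, where the constant is explicit. *)
Lemma slit_lower z : slit z ->
  exists2 k, 0 < k & forall t, 0 < t -> k * (1 + t) <= normc (z + t%:C).
Proof.
move=> sz; suff [k k0 H] : exists2 k, 0 < k & forall t, 0 < t ->
    k * (1 + t) ^+ 2 <= (complex.Re z + t) ^+ 2 + complex.Im z ^+ 2.
  exists (Num.sqrt k) => [|t t0]; first by rewrite sqrtr_gt0.
  rewrite -(@ler_pXn2r _ 2) ?nnegrE ?normc_ge0 ?mulr_ge0 ?sqrtr_ge0 ?addr_ge0 ?(ltW t0)//.
  by have := H t t0; rewrite exprMn sqr_sqrtr ?(ltW k0)// sqr_normcE cReD cImD /= addr0.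
case: z sz => x y /=; rewrite /slit /=; have [->|y0] := eqVneq y 0.
  (* On the positive axis, m = min(x, 1) satisfies m (1 + t) <= x + t. *)
  move=> [/eqP//|x0]; exists (Num.min x 1 ^+ 2).
    by rewrite exprn_gt0// lt_min x0 ltr01.
  move=> t t0; rewrite expr0n addr0 -exprMn.
  have m0 : 0 <= Num.min x 1 by rewrite le_min ltW// ler01.
  have mx : Num.min x 1 <= x by rewrite ge_min lexx.
  have m1 : Num.min x 1 <= 1 by rewrite ge_min lexx orbT.
  have : Num.min x 1 * t <= t by rewrite ler_piMl// ltW.
  move=> mt; rewrite ler_pXn2r ?nnegrE ?mulr_ge0 ?addr_ge0 ?(ltW t0) ?(ltW x0)//.
  by rewrite mulrDr mulr1 lerD.
have q0 : 0 <= (1 - x) ^+ 2 / y ^+ 2 by rewrite divr_ge0 ?sqr_ge0.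
have p0 : 0 < 2 + 2 * ((1 - x) ^+ 2 / y ^+ 2) by lra.
(* Off the real axis write 1 + t = u + v with u = x + t and v = 1 - x; then (u + v)^2 <= 2 u^2 + 2
   v^2 <= (u^2 + y^2) (2 + 2 v^2 / y^2). *)
move=> _; exists (2 + 2 * ((1 - x) ^+ 2 / y ^+ 2))^-1; first by rewrite invr_gt0.
move=> t t0; rewrite mulrC ler_pdivrMr//.
have y2 : 0 < y ^+ 2 by rewrite exprn_even_gt0.
set u := x + t; set v := 1 - x.
have -> : 1 + t = u + v by rewrite /u /v; ring.
have -> : (u ^+ 2 + y ^+ 2) * (2 + 2 * (v ^+ 2 / y ^+ 2)) =
   2 * u ^+ 2 + 2 * y ^+ 2 + 2 * v ^+ 2 + 2 * (u ^+ 2 * v ^+ 2 / y ^+ 2).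
  by field.
have : 0 <= u ^+ 2 * v ^+ 2 / y ^+ 2 by rewrite divr_ge0 ?sqr_ge0// mulr_ge0 ?sqr_ge0.
have := sqr_ge0 (u - v); nra.
Qed.

Lemma stieltjes_bounded_inv z (k : R) : 0 < k ->
  (forall t, 0 < t -> k * (1 + t) <= normc (z + t%:C)) ->
  stieltjes_bounded (fun t => (z + t%:C)^-1) k^-1.
Proof.
move=> k0 H; split; first exact: cmeasurableV (cmeasurable_shift z).
move=> t t0; have kt : 0 < k * (1 + t) by rewrite mulr_gt0// addr_gt0.
by rewrite normcV -invfM lef_pV2 ?posrE ?(lt_le_trans kt) ?H.
Qed.

Lemma stieltjes_bounded_kernel z : slit z ->
  exists K, stieltjes_bounded (fun t => (z + t%:C)^-1) K.
Proof.
by move=> /slit_lower[k k0 H]; exists k^-1; exact: stieltjes_bounded_inv.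
Qed.

Lemma STE z : ST G z = cintegral (fun t => (z + t%:C)^-1).
Proof. by []. Qed.

(** Differentiation under the integral sign with an explicit remainder: [L] is minus the integral of
    (z + t)^-2. *)
Lemma ST_quadratic z : slit z -> exists L K r, 0 < r /\
  forall h, normc h < r ->
    normc (ST G (z + h) - ST G z - h * L) <= K * normc h ^+ 2.
Proof.
move=> /[dup] sz /slit_lower[k k0 H].
have kt (t : R) : 0 < t -> 0 < k * (1 + t) by move=> t0; rewrite mulr_gt0// addr_gt0.
exists (- cintegral (fun t => (z + t%:C)^-1 ^+ 2)), ((2 * k ^- 3) * wint *+ 2), (k / 2).
split=> [|h hk]; first exact: divr_gt0.
(* A perturbation smaller than [k / 2] keeps the lower bound with half the constant, for all [t] at
   once. *)
have H' t : 0 < t -> k / 2 * (1 + t) <= normc (z + h + t%:C).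
  move=> t0; have : normc (z + t%:C) <= normc (z + h + t%:C) + normc h.
    rewrite -(normcN h); apply: le_trans (normc_leD _ _).
    by rewrite addrAC addrK.
  have := H t t0; have : normc h <= k / 2 * (1 + t).
    by rewrite (le_trans (ltW hk))// ler_peMr ?divr_ge0 ?(ltW k0)// lerDl ltW.
  lra.
have kt' (t : R) : 0 < t -> 0 < k / 2 * (1 + t).
  by move=> t0; rewrite mulr_gt0// ?divr_gt0// addr_gt0.
have b1 := stieltjes_bounded_inv k0 H.
have b2 := stieltjes_bounded_inv (divr_gt0 k0 (ltr0n R 2)) H'.
(* In products of kernels one factor keeps its weight and the others are bounded through this
   inequality. *)
have le1 (t : R) : 0 < t -> (1 + t)^-1 <= 1.
  by move=> t0; rewrite invf_le1 ?lerDl ?addr_gt0 ?ltW.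
have b3 : stieltjes_bounded (fun t => (z + t%:C)^-1 ^+ 2) (k ^- 2).
  split; first by apply: cmeasurableM; case: b1.
  move=> t t0; rewrite expr2 normcM.
  have -> : k ^- 2 / (1 + t) = k^-1 / (1 + t) * (k^-1 * 1).
    by field; rewrite !gt_eqF// addr_gt0.
  apply: ler_pM; rewrite ?normc_ge0//; first exact: b1.2.
  by apply: le_trans (b1.2 t t0) _; rewrite ler_pM2l ?invr_gt0// le1.
pose q t := (z + h + t%:C)^-1 - (z + t%:C)^-1.
have bq : stieltjes_bounded q ((k / 2)^-1 + k^-1).
  split; first by apply: cmeasurableD; [case: b2|apply: cmeasurableN; case: b1].
  move=> t t0; apply: le_trans (normc_leD _ _) _; rewrite normcN mulrDl lerD//.
    exact: b2.2.
  exact: b1.2.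
have bz : stieltjes_bounded (fun t => - h * (z + t%:C)^-1 ^+ 2) (normc h * k ^- 2).
  split; first by apply: cmeasurableM; [exact: cmeasurable_cst|case: b3].
  move=> t t0; rewrite normcM normcN -mulrA ler_wpM2l ?normc_ge0//; exact: b3.2.
rewrite !STE -(cintegralB b2 b1) mulrN -mulNr -(cintegralZ (- h) b3).
rewrite -(cintegralB bq bz).
apply: le_trans (cintegral_le (K := 2 * k ^- 3 * normc h ^+ 2) _) _; last first.
  by rewrite [leRHS]mulrnAl [in leRHS]mulrAC.
split.
  by apply: cmeasurableD; [case: bq|apply: cmeasurableN; case: bz].
move=> t t0.
have z1 : z + t%:C != 0.
  apply/eqP => e; have := lt_le_trans (kt t t0) (H t t0).
  by rewrite e normc0 ltxx.
have z2 : z + h + t%:C != 0.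
  apply/eqP => e; have := lt_le_trans (kt' t t0) (H' t t0).
  by rewrite e normc0 ltxx.
(* The first-order remainder of the kernel is exactly h^2 / ((z + h + t) (z + t)^2). Its factors are
   bounded by 2 / k, 1 / k and 1 / k, whence the constant [2 * k ^- 3]. *)
have -> : q t - - h * (z + t%:C)^-1 ^+ 2 =
    h * h * ((z + h + t%:C)^-1 * ((z + t%:C)^-1 * (z + t%:C)^-1)).
  by rewrite /q; field; rewrite z1 z2.
rewrite !normcM mulrC -expr2.
have B1 := b1.2 t t0; have B2 := b2.2 t t0.
have -> : 2 * k ^- 3 * normc h ^+ 2 / (1 + t) =
   ((k / 2)^-1 / (1 + t) * ((k^-1 * 1) * (k^-1 * 1))) * normc h ^+ 2.
  by field; rewrite !gt_eqF// addr_gt0.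
rewrite ler_wpM2r ?sqr_ge0//; apply: ler_pM; rewrite ?normc_ge0 ?mulr_ge0 ?normc_ge0//.
have B3 : normc (z + t%:C)^-1 <= k^-1 * 1.
  by apply: le_trans B1 _; rewrite ler_pM2l ?invr_gt0// le1.
by apply: ler_pM; rewrite ?normc_ge0.
Qed.

(** The inner map is linear, so substituting [a * h] in the quadratic estimate replaces the chain
    rule. Dividing the radius by [1 + normc a] avoids a case distinction on [a]. *)
Lemma derivable_ST_scale (a z : R[i]) : slit (a * z) ->
  derivable ((fun w => ST G (a * w)) : R[i]^o -> R[i]^o) z 1.
Proof.
move=> /ST_quadratic[L [K [r [r0 H]]]].
apply: (@derivable_of_quadratic _ _ _ (a * L) (K * normc a ^+ 2) (r / (1 + normc a))).
  by rewrite divr_gt0// ltr_pwDl// normc_ge0.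
move=> h; rewrite ltr_pdivlMr ?ltr_pwDl ?normc_ge0// => hr.
have -> : h * (a * L) = (a * h) * L by rewrite mulrCA mulrA.
rewrite mulrDr -[leRHS]mulrA -exprMn -normcM; apply: H.
rewrite normcM; have := normc_ge0 h; have := normc_ge0 a; nra.
Qed.

End StieltjesClass.

(** * Lebesgue integrals of the comparison weights *)

Section LebesgueBounds.
Context {R : realType}.
Local Notation leb := (@lebesgue_measure R).
Implicit Types (f phi F : R -> R) (x u v M : R).

(** Restricted to the open half-line because some of the primitives used below, such as [ln], are
    singular at [0]. *)
Definition primitive_pos (F phi : R -> R) := forall t, 0 < t ->
  {for t, continuous phi} /\ is_derive t 1 F (phi t).

Lemma integral_primitive_pos F phi u v : primitive_pos F phi -> 0 < u -> u <= v ->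
  (\int[leb]_(t in `[u, v]) (phi t)%:E = (F v - F u)%:E)%E.
Proof.
move=> H u0; rewrite le_eqVlt => /predU1P[<-|uv].
  by rewrite set_itv1 integral_set1 subrr.
have cF t : 0 < t -> {for t, continuous F}.
  move=> t0; apply: differentiable_continuous; apply/derivable1_diffP.
  by have [_ []] := H t t0.
rewrite (@continuous_FTC2 _ phi F)//.
- apply: continuous_in_subspaceT => t; rewrite inE/= in_itv/= => /andP[ut _].
  by have [] := H t (lt_le_trans u0 ut).
- split.
  + move=> t; rewrite in_itv/= => /andP[ut _].
    by have [_ []] := H t (lt_trans u0 ut).
  + by apply: cvg_at_right_filter; exact: cF.
  + by apply: cvg_at_left_filter; apply: cF; exact: lt_trans uv.
- move=> t; rewrite in_itv/= => /andP[ut _]; rewrite derive1E.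
  by have [_ ?] := H t (lt_trans u0 ut); rewrite derive_val.
Qed.

Lemma measurable_primitive_pos F phi u v : primitive_pos F phi -> 0 < u ->
  measurable_fun `[u, v] phi.
Proof.
move=> H u0; apply: (@measurable_funS _ _ _ _ (`]0, +oo[%classic : set R)).
- exact: measurable_itv.
-  by move=> t /=; rewrite !in_itv/= andbT => /andP[ut _]; exact: lt_le_trans ut.
- apply: open_continuous_measurable_fun; first exact: interval_open.
  by move=> t; rewrite inE/= in_itv/= andbT => t0; have [] := H t t0.
Qed.

(** The tail is exhausted by compact intervals inside the open half-line. The fundamental theorem of
    calculus bounds each piece by [M], and monotone convergence passes to the union. *)
Lemma integral_tail_le f phi F x M : measurable_fun setT f ->
  (forall t, 0 <= f t) -> primitive_pos F phi -> 0 <= x -> 0 <= M ->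
  (forall t, 0 < t -> x <= t -> f t <= phi t) ->
  (forall u v, 0 < u -> x <= u -> u <= v -> F v - F u <= M) ->
  (\int[leb]_(t in `[x, +oo[) (f t)%:E <= M%:E)%E.
Proof.
move=> mf f0 HF x0 M0 fphi FM.
have mfE (A : set R) : measurable A -> measurable_fun A (EFin \o f).
  by move=> mA; apply/measurable_EFinP; exact: measurable_funS mf.
(* The left endpoint is dropped because [x = 0] is allowed and nothing is known about [phi]
   there. *)
rewrite -integral_itv_obnd_cbnd; last exact: mfE.
pose A n : set R := `[x + n.+1%:R^-1, x + n.+1%:R]%classic.
have -> : `]x, +oo[%classic = \bigcup_n A n.
  apply/seteqP; split=> t.
    rewrite /= in_itv/= andbT => xt.
    have tx : 0 < t - x by rewrite subr_gt0.
    (* With this choice [n.+1] exceeds both t - x and its inverse, which gives the two ends of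
       [A n]. *)
    pose n := maxn (Num.truncn (t - x)) (Num.truncn (t - x)^-1).
    exists n => //; rewrite /A /= in_itv/=; apply/andP; split.
      rewrite addrC -lerBrDr -[leRHS]invrK lef_pV2 ?posrE ?invr_gt0//.
      apply: le_trans (ltW (truncnS_gt _)) _.
      by rewrite ler_nat ltnS leq_maxr.
    rewrite -lerBlDl; apply: le_trans (ltW (truncnS_gt _)) _.
    by rewrite ler_nat ltnS leq_maxl.
  move=> [n _]; rewrite /A /= !in_itv/= andbT => /andP[+ _].
  by apply: lt_le_trans; rewrite ltrDl invr_gt0.
have hA : {homo A : n m / (n <= m)%N >-> (n <= m)%O}.
  move=> n m nm; apply/subsetPset => t; rewrite /A /= !in_itv/= => /andP[a b].
  apply/andP; split.
    by apply: le_trans a; rewrite lerD2l lef_pV2 ?posrE// ler_nat ltnS.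
  by apply: le_trans b _; rewrite lerD2l ler_nat ltnS.
have mA n : measurable (A n) by exact: measurable_itv.
have cvgA : (\int[leb]_(t in A n) (f t)%:E @[n --> \oo] -->
    \int[leb]_(t in \bigcup_n A n) (f t)%:E)%E.
  apply: ge0_nondecreasing_set_cvg_integral => //.
    by move=> n; exact: mfE.
  by move=> n t _; rewrite lee_fin.
rewrite -(cvg_lim _ cvgA)//; apply: lime_le; first by apply/cvg_ex; eexists; exact: cvgA.
apply: nearW => n.
have u0 : 0 < x + n.+1%:R^-1 by rewrite ltr_wpDl// invr_gt0.
have xu : x <= x + n.+1%:R^-1 by rewrite lerDl invr_ge0.
have uv : x + n.+1%:R^-1 <= x + n.+1%:R.
  by rewrite lerD2l (@le_trans _ _ 1) ?ler1n// invf_le1 ?ler1n.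
apply: (@le_trans _ _ (\int[leb]_(t in A n) (phi t)%:E)%E).
  apply: ge0_le_integral; first exact: mA.
  - by move=> t _; rewrite lee_fin.
  - exact: mfE.
  - apply/measurable_EFinP; exact: measurable_primitive_pos HF u0.
  - move=> t; rewrite /A /= in_itv/= => /andP[ut _]; rewrite lee_fin fphi//.
      exact: lt_le_trans ut.
    exact: le_trans ut.
by rewrite (integral_primitive_pos HF u0 uv) lee_fin FM.
Qed.

(** For a lower bound, a single compact interval suffices and no limit is taken. *)
Lemma integral_tail_ge f phi F x u v : measurable_fun setT f ->
  (forall t, 0 <= f t) -> primitive_pos F phi -> x <= u -> 0 < u -> u <= v ->
  (forall t, u <= t <= v -> 0 <= phi t <= f t) ->
  ((F v - F u)%:E <= \int[leb]_(t in `[x, +oo[) (f t)%:E)%E.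
Proof.
move=> mf f0 HF xu u0 uv phif.
have mfE (A : set R) : measurable A -> measurable_fun A (EFin \o f).
  by move=> mA; apply/measurable_EFinP; exact: measurable_funS mf.
rewrite -(integral_primitive_pos HF u0 uv).
apply: (@le_trans _ _ (\int[leb]_(t in `[u, v]) (f t)%:E)%E).
  apply: ge0_le_integral => //.
  - by move=> t; rewrite /= in_itv/= lee_fin => /phif/andP[].
  - apply/measurable_EFinP; exact: measurable_primitive_pos HF u0.
  - exact: mfE.
  - by move=> t; rewrite /= in_itv/= lee_fin => /phif/andP[].
apply: ge0_subset_integral => //.
- exact: mfE.
- by move=> t _; rewrite lee_fin.
- by move=> t; rewrite /= !in_itv/= andbT => /andP[+ _]; exact: le_trans.
Qed.

Lemma is_derive_continuous (f : R -> R) (t df : R) :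
  is_derive t 1 f df -> {for t, continuous f}.
Proof. by move=> [df' _]; exact/differentiable_continuous/derivable1_diffP. Qed.

Lemma is_derive_addl (t : R) : is_derive t 1 (fun x => 1 + x) 1.
Proof.
exact: (is_derive_eq (is_deriveD (is_derive_cst (1 : R) t 1) (is_derive_id t (1 : R)))
  (add0r _)).
Qed.

(** This rule and the following ones state the functions pointwise, as the explicit primitives below
    are written. *)
Lemma is_derive_mull (k t df : R) f :
  is_derive t 1 f df -> is_derive t 1 (fun x => k * f x) (k * df).
Proof. exact: is_deriveZ. Qed.

Lemma is_derive_sub (t df dg : R) f g :
  is_derive t 1 f df -> is_derive t 1 g dg ->
  is_derive t 1 (fun x => f x - g x) (df - dg).
Proof. exact: is_deriveB. Qed.

Lemma is_derive_mul (t df dg : R) f g :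
  is_derive t 1 f df -> is_derive t 1 g dg ->
  is_derive t 1 (fun x => f x * g x) (f t * dg + g t * df).
Proof. exact: is_deriveM. Qed.

Lemma is_derive_inv (t df : R) f : f t != 0 -> is_derive t 1 f df ->
  is_derive t 1 (fun x => (f x)^-1) (- f t ^- 2 * df).
Proof. exact: is_deriveV. Qed.

Lemma is_derive_powR_comp (t df p : R) f : 0 < f t -> is_derive t 1 f df ->
  is_derive t 1 (fun x => f x `^ p) (p * f t `^ (p - 1) * df).
Proof.
by move=> f0; exact: (is_derive1_comp (f := fun y => y `^ p) (is_derive1_powR p f0)).
Qed.

Definition moment_weight (p : R) : R -> R := fun t => t `^ p / (t ^+ 2 + 1).

Lemma moment_weight_ge0 p t : 0 <= moment_weight p t.
Proof. by rewrite divr_ge0 ?powR_ge0// addr_ge0 ?sqr_ge0. Qed.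

Lemma measurable_moment_weight p : measurable_fun setT (moment_weight p).
Proof.
apply: measurable_funM; first exact: measurable_powR.
apply: measurable_inv_nonneg; first by move=> t; rewrite addr_ge0 ?sqr_ge0.
by apply: measurable_funD => //; exact: measurable_funX.
Qed.

(* Any bounded primitive with a comparable derivative will do:
   [- (1 + t) ^ a] at order [1 + a], [(t / (1 + t)) ^ (a + 1)] at order [a]
   and [2 ln (t / (1 + t))] at order [-1]. *)
Lemma moment1_le (a x : R) : -1 <= a < 0 -> 0 <= x ->
  (\int[leb]_(t in `[x, +oo[) (moment_weight (1 + a) t)%:E <= (- (2 / a))%:E)%E.
Proof.
move=> /andP[a1 a0] x0.
have M0 : 0 <= - (2 / a) by rewrite -mulrN -invrN divr_ge0// oppr_ge0 ltW.
apply: (@integral_tail_le _ (fun t => 2 * (1 + t) `^ (a - 1))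
    (fun t => (2 / a) * (1 + t) `^ a)) => //.
- exact: measurable_moment_weight.
- exact: moment_weight_ge0.
- move=> t t0; have t1 : 0 < 1 + t by rewrite addr_gt0.
  have D p := is_derive_powR_comp p t1 (is_derive_addl t).
  split; first exact: is_derive_continuous (is_derive_mull 2 (D (a - 1))).
  by apply: is_derive_eq (is_derive_mull (2 / a) (D a)) _; field; rewrite lt_eqF.
- move=> t t0 _; have t1 : 0 < 1 + t by rewrite addr_gt0.
  rewrite /moment_weight ler_pdivrMr ?ltr_wpDl ?sqr_ge0//.
  (* As 1 + a >= 0, t may be replaced by 1 + t in the power; two factors 1 + t are then split off,
     and (1 + t)^2 <= 2 (t^2 + 1). *)
  apply: (@le_trans _ _ ((1 + t) `^ (1 + a))).
    by apply: ge0_ler_powR; rewrite ?nnegrE ?(ltW t0) ?(ltW t1) ?lerDr//; lra.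
  have -> : (1 + t) `^ (1 + a) = (1 + t) `^ (a - 1) * (1 + t) ^+ 2.
    have -> : 1 + a = (a - 1) + 2%:R by lra.
    by rewrite powRD ?(gt_eqF t1) ?implybT// powR_mulrn ?(ltW t1).
  rewrite [leRHS]mulrAC [leRHS]mulrC; apply: ler_wpM2l; first exact: powR_ge0.
  have := sqr_ge0 (1 - t); nra.
- move=> u v u0 _ uv; rewrite -mulrBr -(mulrN1 (2 / a)) -subr_ge0 -mulrBr.
  rewrite -mulrA mulr_ge0// -mulrNN mulr_ge0 ?oppr_ge0 ?invr_le0 ?(ltW a0)//.
  have := powR_ge0 (1 + v) a.
  have : (1 + u) `^ a <= 1.
    rewrite -[leRHS](@powRr0 _ (1 + u)); apply: ler_powR; [lra|exact: ltW].
  lra.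
Qed.

Lemma moment0_le (a x : R) : -1 < a < 0 -> 0 <= x ->
  (\int[leb]_(t in `[x, +oo[) (moment_weight a t)%:E <= (2 / (a + 1))%:E)%E.
Proof.
move=> /andP[a1 a0] x0; have p0 : 0 < a + 1 by lra.
have M0 : 0 <= 2 / (a + 1) by rewrite divr_ge0// ltW.
apply: (@integral_tail_le _
    (fun t => 2 / (a + 1) * ((a + 1) * (t / (1 + t)) `^ a * (1 + t) ^- 2))
    (fun t => 2 / (a + 1) * (t / (1 + t)) `^ (a + 1))) => //.
- exact: measurable_moment_weight.
- exact: moment_weight_ge0.
- move=> t t0; have t1 : 0 < 1 + t by rewrite addr_gt0.
  have t2 : 0 < t / (1 + t) by rewrite divr_gt0.
  have t1' : 1 + t != 0 by rewrite gt_eqF.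
  have Dv := is_derive_inv t1' (is_derive_addl t).
  have Dq : is_derive t 1 (fun t => t / (1 + t)) ((1 + t) ^- 2).
    by apply: is_derive_eq (is_derive_mul (is_derive_id t 1) Dv) _; field.
  have D p := is_derive_powR_comp (f := fun t => t / (1 + t)) p t2 Dq.
  split.
    have Dv2 := is_derive_inv (f := fun x => (1 + x) * (1 + x))
      (expf_neq0 2 t1') (is_derive_mul (is_derive_addl t) (is_derive_addl t)).
    have D1 := is_derive_mul (is_derive_mull (a + 1) (D a)) Dv2.
    exact: is_derive_continuous (is_derive_mull (2 / (a + 1)) D1).
  by have := is_derive_mull (2 / (a + 1)) (D (a + 1)); rewrite addrK.
- move=> t t0 _; have t1 : 0 < 1 + t by rewrite addr_gt0.
  rewrite /moment_weight ler_pdivrMr ?ltr_wpDl ?sqr_ge0//.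
  rewrite powRM ?invr_ge0 ?(ltW t0) ?(ltW t1)// -mulrA.
  have -> : (1 + t)^-1 `^ a = ((1 + t) `^ a)^-1.
    by rewrite -[(1 + t)^-1]powR_inv1 ?(ltW t1)// -powRrM mulN1r powRN.
  have aa : (1 + t) `^ a <= 1.
    rewrite -[leRHS](@powRr0 _ (1 + t)); apply: ler_powR; [lra|exact: ltW].
  have i1 : 1 <= ((1 + t) `^ a)^-1 by rewrite invf_ge1 ?powR_gt0.
  (* Both factors multiplying t^a are at least 1: the first because a < 0, the second because (1 +
     t)^2 <= 2 (t^2 + 1). *)
  rewrite [leRHS](_ : _ = t `^ a * (((1 + t) `^ a)^-1 *
      (2 * (t ^+ 2 + 1) / (1 + t) ^+ 2))); last first.
    by field; rewrite !gt_eqF// powR_gt0.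
  rewrite ler_peMr ?powR_ge0//.
  have i2 : 1 <= 2 * (t ^+ 2 + 1) / (1 + t) ^+ 2.
    by rewrite ler_pdivlMr ?exprn_gt0// mul1r; have := sqr_ge0 (1 - t); nra.
  nra.
- move=> u v u0 _ uv; rewrite -mulrBr ler_piMr//.
  have := powR_ge0 (u / (1 + u)) (a + 1).
  have : (v / (1 + v)) `^ (a + 1) <= 1.
    have v0 := lt_le_trans u0 uv.
    have e1 : 1 `^ (a + 1) = 1 :> R by rewrite powR1.
    rewrite -[leRHS]e1; apply: ge0_ler_powR; rewrite ?nnegrE ?(ltW p0)
      ?(ltW (divr_gt0 v0 (addr_gt0 ltr01 v0)))//.
    by rewrite ler_pdivrMr ?mul1r ?addr_gt0// lerDr.
  lra.
Qed.

Lemma moment0_le_ln (x : R) : 0 < x ->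
  (\int[leb]_(t in `[x, +oo[) (moment_weight (-1) t)%:E
     <= (2 * ln ((1 + x) / x))%:E)%E.
Proof.
move=> x0.
have P (t : R) : 0 < t -> (1 + t) / t \is Num.pos /\ 1 <= (1 + t) / t.
  move=> t0; split; first by rewrite posrE divr_gt0 ?addr_gt0.
  by rewrite ler_pdivlMr// mul1r lerDr.
apply: (@integral_tail_le _ (fun t => 2 * (t^-1 - (1 + t)^-1))
    (fun t => 2 * (ln t - ln (1 + t)))) => //.
- exact: measurable_moment_weight.
- exact: moment_weight_ge0.
- move=> t t0; have t1 : 0 < 1 + t by rewrite addr_gt0.
  have t1' : 1 + t != 0 by rewrite gt_eqF.
  have t0' : t != 0 by rewrite gt_eqF.
  have D : is_derive t 1 (fun t => ln (1 + t)) (1 + t)^-1.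
    exact: (is_derive_eq (is_derive1_comp (f := @ln R) (is_derive1_ln t1)
      (is_derive_addl t)) (mulr1 _)).
  split; last exact: is_derive_mull (is_derive_sub (is_derive1_ln t0) D).
  have D1 := is_derive_sub (is_derive_inv t0' (is_derive_id t 1))
    (is_derive_inv t1' (is_derive_addl t)).
  exact: is_derive_continuous (is_derive_mull 2 D1).
- exact: ltW.
- by have [_ ?] := P x x0; rewrite mulr_ge0// ln_ge0.
- move=> t t0 _; have t1 : 0 < 1 + t by rewrite addr_gt0.
  rewrite /moment_weight powR_inv1 ?(ltW t0)//.
  rewrite ler_pdivrMr ?ltr_wpDl ?sqr_ge0//.
  have -> : 2 * (t^-1 - (1 + t)^-1) * (t ^+ 2 + 1) = t^-1 * (2 * (t ^+ 2 + 1) / (1 + t)).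
    by field; rewrite !gt_eqF.
  rewrite ler_peMr ?invr_ge0 ?(ltW t0)// ler_pdivlMr// mul1r.
  have := sqr_ge0 (t - 2^-1); nra.
- move=> u v u0 xu uv; have v0 := lt_le_trans u0 uv.
  (* The primitive is negative and increasing, so its increments on [x, +oo[ are at most minus its
     value at [x]. *)
  have e (w : R) : 0 < w -> ln w - ln (1 + w) = - ln ((1 + w) / w).
    by move=> w0; rewrite ln_div ?posrE ?addr_gt0// opprB.
  rewrite -mulrBr !e// opprK ler_pM2l//.
  have [_ /ln_ge0] := P v v0.
  have : ln ((1 + u) / u) <= ln ((1 + x) / x).
    rewrite ler_ln; [|by case: (P u u0)|by case: (P x x0)].
    rewrite ler_pdivrMr// mulrAC ler_pdivlMr//; nra.
  lra.
Qed.

(** On [x, 1] the denominator is at most 2, so the weight is at least 1 / (2 t). The lower limit [y]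
    is separate from [x] so that the case [y = 0], with [x] arbitrarily small, exhibits the
    divergence of the full integral. *)
Lemma moment0_ge_ln (x : R) : 0 < x <= 1 -> forall y, 0 <= y <= x ->
  ((ln x^-1 / 2)%:E <= \int[leb]_(t in `[y, +oo[) (moment_weight (-1) t)%:E)%E.
Proof.
move=> /andP[x0 x1] y /andP[y0 yx].
have -> : ln x^-1 / 2 = ln 1 / 2 - ln x / 2 by rewrite lnV ?posrE// ln1 mulNr mul0r sub0r.
apply: (@integral_tail_ge _ (fun t => t^-1 / 2) (fun t => ln t / 2)) => //.
- exact: measurable_moment_weight.
- exact: moment_weight_ge0.
- move=> t t0; have t0' : t != 0 by rewrite gt_eqF.
  have C (k df : R) f : is_derive t 1 f df -> is_derive t 1 (fun x => f x / k) (df / k).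
    by rewrite mulrC => /(is_derive_mull k^-1); under eq_fun do rewrite mulrC.
  split; last exact: C (is_derive1_ln t0).
  exact: is_derive_continuous (C 2 _ _ (is_derive_inv t0' (is_derive_id t 1))).
- move=> t /andP[xt t1]; have t0 := lt_le_trans x0 xt.
  rewrite mulr_ge0 ?invr_ge0 ?(ltW t0)//=.
  rewrite /moment_weight powR_inv1 ?(ltW t0)// ler_pM2l ?invr_gt0//.
  by rewrite lef_pV2 ?posrE ?ltr_wpDl ?sqr_ge0//; nra.
Qed.

(** On [1, 2] one has t^p >= 1 / t >= 1 / 2 and t^2 + 1 <= 5, and this interval has length 1. *)
Lemma moment_ge_cst (p x : R) : -1 <= p -> x <= 1 ->
  ((10^-1)%:E <= \int[leb]_(t in `[x, +oo[) (moment_weight p t)%:E)%E.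
Proof.
move=> p1 x1; have -> : 10^-1 = 2 / 10 - 1 / 10 :> R by lra.
apply: (@integral_tail_ge _ (fun t => 10^-1) (fun t => t / 10)); rewrite ?ler1n//.
- exact: measurable_moment_weight.
- exact: moment_weight_ge0.
- move=> t t0; split; first exact: cst_continuous.
  rewrite -[X in is_derive _ _ _ X]mulr1; have := is_derive_mull 10^-1 (is_derive_id t 1).
  by under eq_fun do rewrite mulrC.
- move=> t /andP[t1 t2]; rewrite invr_ge0 ler0n /=.
  have t0 : 0 < t := lt_le_trans ltr01 t1.
  apply: (@le_trans _ _ (2^-1 / 5)); first lra.
  apply: ler_pM; rewrite ?invr_ge0//.
    apply: (@le_trans _ _ t^-1); first by rewrite lef_pV2 ?posrE.
    by rewrite -powR_inv1 ?(ltW t0)// ler_powR.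
  by rewrite lef_pV2 ?posrE ?ltr_wpDl ?sqr_ge0//; nra.
Qed.

End LebesgueBounds.

(** * Moments of the measure *)

Section Moments.
Context {R : realType}.
Implicit Types (G : {measure set R -> \bar R}) (rho mu : R) (k : nat).
Local Notation D0 := (`]0, +oo[%classic : set R).

(** The integrand [t ^+ k / (t ^+ 2 + 1)] of the hypothesis evaluated at [t / rho], with the inner
    fractions cleared; the values [k = 0] and [k = 1] give I_0 and I_1. *)
Definition mker k rho t : R := t ^+ k * rho ^+ (2 - k) / (t ^+ 2 + rho ^+ 2).

Definition moment G k rho : R := \int[G]_(t in D0) mker k rho t.

Lemma measurable_mker k rho (D : set R) : measurable_fun D (mker k rho).
Proof.
apply: measurable_funM.
  by apply: measurable_funM => //; exact: measurable_funX.
apply: measurable_inv_nonneg; first by move=> t; rewrite addr_ge0 ?sqr_ge0.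
by apply: measurable_funD => //; exact: measurable_funX.
Qed.

Lemma mker_ge0 k rho t : 0 <= rho -> 0 <= t -> 0 <= mker k rho t.
Proof. by move=> r0 t0; rewrite divr_ge0 ?mulr_ge0 ?exprn_ge0// addr_ge0 ?sqr_ge0. Qed.

Lemma integrable_mker G k rho : (k <= 1)%N -> 1 <= rho ->
  (\int[G]_(t in `]0%R, +oo[) ((1 + t)^-1)%:E < +oo)%E ->
  G.-integrable D0 (EFin \o mker k rho).
Proof.
move=> k1 r1 SG; have r0 : 0 < rho by exact: lt_le_trans r1.
apply: (integrable_le_weight SG (K := 2 * rho ^+ 2)); first exact: measurable_mker.
move=> t t0; rewrite ger0_norm ?mker_ge0 ?(ltW r0) ?(ltW t0)//.
have N0 : 0 < t ^+ 2 + rho ^+ 2 by rewrite ltr_wpDl ?sqr_ge0 ?exprn_gt0.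
rewrite /mker ler_pdivrMr// mulrAC ler_pdivlMr ?addr_gt0//.
have e2 : 1 <= rho ^+ 2 by rewrite exprn_ege1.
case: k k1 => [|[|//]] _; rewrite ?expr0 ?expr1 ?mul1r ?subn0 ?subSS.
  have -> : 2 * rho ^+ 2 * (t ^+ 2 + rho ^+ 2) =
    rho ^+ 2 * (2 * (t ^+ 2 + rho ^+ 2)) by ring.
  by rewrite ler_pM2l ?exprn_gt0//; have := sqr_ge0 (t - 2^-1); nra.
have -> : t * rho * (1 + t) = rho * (t + t ^+ 2) by ring.
have -> : 2 * rho ^+ 2 * (t ^+ 2 + rho ^+ 2) =
  rho * (2 * (rho * (t ^+ 2 + rho ^+ 2))) by ring.
rewrite ler_pM2l//; have : t ^+ 2 + rho ^+ 2 <= rho * (t ^+ 2 + rho ^+ 2).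
  by rewrite ler_peMl// ltW.
have := sqr_ge0 (t - 1); nra.
Qed.

Lemma moment_ge0 G k rho : 0 <= rho -> 0 <= moment G k rho.
Proof.
by move=> r0; apply: Rintegral_ge0 => t /D0P/ltW t0; exact: mker_ge0.
Qed.

Lemma integral_setU_null G (A N : set R) (f : R -> R) :
  measurable A -> measurable N -> G N = 0%E -> [disjoint A & N] ->
  measurable_fun (A `|` N) f -> (forall t, (A `|` N) t -> 0 <= f t) ->
  (\int[G]_(t in A `|` N) (f t)%:E = \int[G]_(t in A) (f t)%:E)%E.
Proof.
move=> mA mN N0 dAN mf f0; rewrite ge0_integral_setU//.
- rewrite (null_set_integral mN _ N0) ?adde0//.
  by apply/measurable_EFinP; apply: measurable_funS mf => //; exact: measurableU.
- by apply/measurable_EFinP.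
Qed.

(** Translates the middle term of the hypothesis into a real-valued moment: the pushforward is a
    change of variable, and [mu, +oo[ differs from ]0, +oo[ by a [G]-null set. *)
Lemma rescale_moment mu G k rho : 0 <= mu -> SM mu G -> (k <= 1)%N -> 1 <= rho ->
  (\int[rescale rho G]_(t in `[(mu / rho)%R, +oo[) (t ^+ k / (t ^+ 2 + 1))%:E
   = (moment G k rho)%:E)%E.
Proof.
move=> mu0 [G0 Gmu SG] k1 r1; have r0 : 0 < rho by exact: lt_le_trans r1.
pose f : R -> R := fun t => t ^+ k / (t ^+ 2 + 1).
have mf (D : set R) : measurable_fun D f.
  apply: measurable_funM; first exact: measurable_funX.
  apply: measurable_inv_nonneg; first by move=> t; rewrite addr_ge0 ?sqr_ge0.
  by apply: measurable_funD => //; exact: measurable_funX.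
rewrite /rescale ge0_integral_pushforward//=; last 3 first.
- exact: measurable_funM.
- by apply/measurable_EFinP; exact: mf.
- move=> t; rewrite inE/= in_itv/= andbT => tm; rewrite lee_fin.
  by rewrite divr_ge0 ?exprn_ge0 ?(le_trans _ tm) ?divr_ge0 ?(ltW r0)// addr_ge0 ?sqr_ge0.
have -> : (fun t : R => t / rho) @^-1` `[mu / rho, +oo[ = `[mu, +oo[%classic.
  by apply/seteqP; split => t; rewrite /= !in_itv/= !andbT ler_pM2r ?invr_gt0.
transitivity (\int[G]_(t in `[mu, +oo[) (mker k rho t)%:E)%E.
  apply: eq_integral => t _; congr EFin; rewrite /mker.
  have N0 : t ^+ 2 + rho ^+ 2 != 0.
    by rewrite gt_eqF// ltr_wpDl ?sqr_ge0 ?exprn_gt0.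
  case: k k1 {f mf} => [|[|//]] _; rewrite ?expr0 ?expr1 ?mul1r ?subn0 ?subSS; field;
    by rewrite (gt_eqF r0) N0.
have nul (N : set R) : measurable N -> N `<=` `]-oo, 0]%classic `|` `]-oo, mu[%classic -> G N = 0%E.
  move=> mN sN; apply: (@subset_measure0 _ _ _ G N _ mN _ sN).
    by apply: measurableU; exact: measurable_itv.
  apply/eqP; rewrite eq_le measure_ge0 andbT.
  apply: le_trans (measureU2 _ _ _) _; try exact: measurable_itv.
  by rewrite [X in (X + _)%E]G0 [X in (_ + X)%E]Gmu adde0.
have -> : (\int[G]_(t in `[mu, +oo[) (mker k rho t)%:E = \int[G]_(t in D0) (mker k rho t)%:E)%E.
  (* For [mu = 0] the two domains differ by the point 0, which belongs to the null set ]-oo, 0]; for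
     [mu > 0] they differ by ]0, mu[. *)
  move: mu0; rewrite le_eqVlt => /predU1P[m0|m0].
    rewrite -m0 -[RHS](@integral_setU_null G D0 [set 0]).
    - congr (integral _ _ _); apply/seteqP; split => t /=; rewrite !in_itv/= !andbT.
        by rewrite le_eqVlt => /predU1P[<-|]; [right|left].
      by case=> [/ltW|->].
    - exact: measurable_itv.
    - exact: measurable_set1.
    - by apply: nul; [exact: measurable_set1|move=> t -> /=; left; rewrite in_itv/=].
    - by apply/disj_setPS => t /= [] /[swap] ->; rewrite in_itv/= ltxx.
    - exact: measurable_mker.
    - move=> t [/D0P|->]; last exact: mker_ge0 (ltW r0) _.
      by move=> /ltW; exact: mker_ge0 (ltW r0).
  rewrite -[LHS](@integral_setU_null G _ `]0, mu[%classic).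
  - congr (integral _ _ _); apply/seteqP; split => t /=; rewrite !in_itv/= !andbT.
      by case=> [/(lt_le_trans m0)|/andP[]].
    by move=> t0; case: (leP mu t) => tm; [left|right; rewrite t0].
  - exact: measurable_itv.
  - exact: measurable_itv.
  - apply: nul; first exact: measurable_itv.
    by move=> t /=; rewrite !in_itv/= => /andP[_ tm]; right.
  - apply/disj_setPS => t /= []; rewrite !in_itv/= andbT => a /andP[_ b].
    by have := le_lt_trans a b; rewrite ltxx.
  - exact: measurable_mker.
  - move=> t /= []; rewrite in_itv/=.
      by rewrite andbT => a; exact: mker_ge0 (ltW r0) (le_trans (ltW m0) a).
    by move=> /andP[a _]; exact: mker_ge0 (ltW r0) (ltW a).
by rewrite /moment /Rintegral fineK//; apply: integrable_fin_num => //; exact: integrable_mker.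
Qed.

End Moments.

(** * Growth of the moments in [rho] *)

Section MomentBounds.
Context {R : realType} (mu : R) (G : {measure set R -> \bar R}) (alpha C c rho0 : R).
Hypotheses (hmu : 0 <= mu) (hG : SM mu G) (hC : 0 < C) (hc : 0 < c) (hrho0 : 1 <= rho0).
Hypothesis hbound : forall (k : nat) (rho : R), (k <= 1)%N -> rho0 <= rho ->
  ((c * rho `^ (alpha + 1))%:E *
     \int[lebesgue_measure]_(t in `[(mu / rho)%R, +oo[)
        (t `^ (k%:R + alpha) / (t ^+ 2 + 1))%:E
   <= \int[rescale rho G]_(t in `[(mu / rho)%R, +oo[)
        (t ^+ k / (t ^+ 2 + 1))%:E
   <= (C * rho `^ (alpha + 1))%:E *
     \int[lebesgue_measure]_(t in `[(mu / rho)%R, +oo[)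
        (t `^ (k%:R + alpha) / (t ^+ 2 + 1))%:E)%E.

Lemma moment_le k rho M : (k <= 1)%N -> rho0 <= rho ->
  (\int[lebesgue_measure]_(t in `[(mu / rho)%R, +oo[)
     (moment_weight (k%:R + alpha) t)%:E <= M%:E)%E ->
  moment G k rho <= C * rho `^ (alpha + 1) * M.
Proof.
move=> k1 hr HM; have /andP[_] := hbound k1 hr.
rewrite (rescale_moment hmu hG k1 (le_trans hrho0 hr)) => H.
rewrite -lee_fin; apply: le_trans H _; rewrite [leRHS]EFinM.
by apply: lee_wpmul2l => //; rewrite lee_fin mulr_ge0 ?powR_ge0 ?(ltW hC).
Qed.

Lemma moment_ge k rho m : (k <= 1)%N -> rho0 <= rho ->
  (m%:E <= \int[lebesgue_measure]_(t in `[(mu / rho)%R, +oo[)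
     (moment_weight (k%:R + alpha) t)%:E)%E ->
  c * rho `^ (alpha + 1) * m <= moment G k rho.
Proof.
move=> k1 hr HM; have /andP[+ _] := hbound k1 hr.
rewrite (rescale_moment hmu hG k1 (le_trans hrho0 hr)) => H.
rewrite -lee_fin; apply: le_trans H; rewrite [leLHS]EFinM.
by apply: lee_wpmul2l => //; rewrite lee_fin mulr_ge0 ?powR_ge0 ?(ltW hc).
Qed.

(** Once [rho >= mu], the lower limit [mu / rho] lies in [0, 1], where the comparison integrals are
    bounded above and below by positive constants. *)
Lemma moment_power : -1 < alpha < 0 -> exists c1 C1 r : R,
  [/\ 0 < c1, 0 < C1, 1 <= r & forall k rho, (k <= 1)%N -> r <= rho ->
    c1 * rho `^ (alpha + 1) <= moment G k rho <= C1 * rho `^ (alpha + 1)].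
Proof.
move=> /andP[a1 a0].
have M0 : 0 < 2 / (alpha + 1) by rewrite divr_gt0//; lra.
have M1 : 0 < - (2 / alpha) by rewrite -mulrN -invrN divr_gt0// oppr_gt0.
(* [2 / (alpha + 1)] serves [k = 0] and [- (2 / alpha)] serves [k = 1]; their sum serves both. *)
exists (c / 10), (C * (2 / (alpha + 1) - 2 / alpha)), (Num.max rho0 mu).
split; rewrite ?divr_gt0 ?mulr_gt0 ?addr_gt0 ?le_max ?hrho0//.
move=> k rho k1; rewrite ge_max => /andP[r1 rmu].
have r0 : 0 < rho by exact: lt_le_trans (le_trans hrho0 r1).
have x0 : 0 <= mu / rho by rewrite divr_ge0// ltW.
have x1 : mu / rho <= 1 by rewrite ler_pdivrMr ?mul1r.
apply/andP; split.
  rewrite mulrAC; apply: (moment_ge k1 r1); apply: moment_ge_cst => //.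
  by case: k k1 => [|[|//]] _; lra.
rewrite mulrAC; apply: (moment_le k1 r1).
case: k k1 => [|[|//]] _.
  rewrite add0r; apply: le_trans (moment0_le _ x0) _; first by rewrite a1 a0.
  by rewrite lee_fin lerDl ltW.
apply: le_trans (moment1_le _ x0) _; first by rewrite a0 andbT ltW.
by rewrite lee_fin lerDr ltW.
Qed.

(** The power of [rho] is now constant, and the growth of I_0 comes from the lower limit [mu / rho]
    tending to 0, where the weight behaves like 1 / t. *)
Lemma moment_log : alpha = -1 -> exists c1 C1 r : R,
  [/\ 0 < c1, 0 < C1, 1 <= r & forall rho, r <= rho ->
    [/\ c1 * ln rho <= moment G 0 rho, moment G 0 rho <= C1 * ln rho
      & moment G 1 rho <= C1]].
Proof.
move=> a1; have a0 : alpha + 1 = 0 by rewrite a1 addNr.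
have mupos : 0 < mu.
  rewrite lt_def hmu andbT; apply/eqP => m0.
  (* If [mu = 0], the comparison integral at [rho0] diverges. Already its part above [expR (- n)] is
     at least [n / 2], which would make the finite moment at least itself plus [c / 2]. *)
  pose n := 2 * moment G 0 rho0 / c + 1.
  have n0 : 0 < n.
    by rewrite ltr_wpDl// divr_ge0 ?(ltW hc)// mulr_ge0// moment_ge0// (le_trans ler01).
  have H : ((ln (expR (- n))^-1 / 2)%:E <= \int[lebesgue_measure]_(t in `[(mu / rho0)%R, +oo[)
      (moment_weight (0%:R + alpha) t)%:E)%E.
    rewrite m0 mul0r add0r a1; apply: (@moment0_ge_ln _ (expR (- n))).
      by rewrite expR_gt0 -expR0 ler_expR oppr_le0 ltW.
    by rewrite lexx ltW ?expR_gt0.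
  have := moment_ge (leq0n 1) (lexx rho0) H.
  rewrite a0 powRr0 mulr1 -expRN opprK expRK /n.
  have -> : c * ((2 * moment G 0 rho0 / c + 1) / 2) = moment G 0 rho0 + c / 2.
    by field; rewrite gt_eqF.
  by move=> h; move: h hc; lra.
(* From [rho >= mu ^+ 2], ln (rho / mu) is at least half of ln rho, which gives [c / 4]. The bounds
   2 and [2 / mu] ensure 1 + rho / mu <= rho^2, which gives [4 * C]; the bound [mu] makes [mu / rho]
   at most 1. *)
exists (c / 4), (4 * C), (Num.max rho0 (Num.max (mu ^+ 2) (Num.max mu (Num.max 2 (2 / mu))))).
split; rewrite ?divr_gt0 ?mulr_gt0 ?le_max ?hrho0//.
move=> rho; rewrite !ge_max => /and5P[r1 rmu2 rmu r2 r2mu].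
have r0 : 0 < rho by exact: lt_le_trans r2.
have x0 : 0 < mu / rho by rewrite divr_gt0.
have x1 : mu / rho <= 1 by rewrite ler_pdivrMr ?mul1r.
split.
- have H : ((ln (mu / rho)^-1 / 2)%:E <= \int[lebesgue_measure]_(t in `[(mu / rho)%R, +oo[)
      (moment_weight (0%:R + alpha) t)%:E)%E.
    by rewrite add0r a1; apply: moment0_ge_ln; rewrite ?x0 ?x1// lexx ltW.
  apply: le_trans (moment_ge (leq0n 1) r1 H).
  rewrite a0 powRr0 mulr1 invf_div ln_div ?posrE//.
  have : ln (mu ^+ 2) <= ln rho by rewrite ler_ln ?posrE// exprn_gt0.
  rewrite lnXn// mulr2n => h.
  have : 0 <= c * (ln rho - (ln mu + ln mu)) by rewrite mulr_ge0 ?(ltW hc)// subr_ge0.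
  lra.
- have H : (\int[lebesgue_measure]_(t in `[(mu / rho)%R, +oo[)
      (moment_weight (0%:R + alpha) t)%:E <= (2 * ln ((1 + mu / rho) / (mu / rho)))%:E)%E.
    by rewrite add0r a1; apply: moment0_le_ln.
  apply: le_trans (moment_le (leq0n 1) r1 H) _.
  rewrite a0 powRr0 mulr1.
  have : ln ((1 + mu / rho) / (mu / rho)) <= ln (rho ^+ 2).
    rewrite ler_ln ?posrE ?divr_gt0 ?addr_gt0 ?exprn_gt0//.
    have -> : (1 + mu / rho) / (mu / rho) = 1 + rho / mu.
      by field; rewrite !gt_eqF.
    have : rho / mu <= rho * (rho / 2).
      rewrite ler_pM2l// -[leLHS]mul1r ler_pdivrMr//.
      by move: r2mu; rewrite ler_pdivrMr//; lra.
    nra.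
  rewrite lnXn// mulr2n => h.
  have : 0 <= C * (ln rho + ln rho - ln ((1 + mu / rho) / (mu / rho))).
    by rewrite mulr_ge0 ?(ltW hC)// subr_ge0.
  lra.
- have H : (\int[lebesgue_measure]_(t in `[(mu / rho)%R, +oo[)
      (moment_weight (1%:R + alpha) t)%:E <= (- (2 / alpha))%:E)%E.
    by apply: moment1_le (ltW x0); rewrite a1 lexx ltrN10.
  apply: le_trans (moment_le (leqnn 1) r1 H) _.
  rewrite a0 powRr0 mulr1 a1 invrN1; move: hC; lra.
Qed.

End MomentBounds.

(** * Bounds on the Stieltjes kernel *)

Section Kernel.
Context {R : realType} (G : {measure set R -> \bar R}).
Hypothesis SG : (\int[G]_(t in `]0%R, +oo[) ((1 + t)^-1)%:E < +oo)%E.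
Local Notation D0 := (`]0, +oo[%classic : set R).

Lemma integrable_lin_mker (a b rho : R) : 1 <= rho ->
  G.-integrable D0 (EFin \o (fun t => a * mker 0 rho t + b * mker 1 rho t)).
Proof.
move=> r1; apply: (integrableD measurable_D0
  (f := fun t => (a * mker 0 rho t)%:E) (g := fun t => (b * mker 1 rho t)%:E)).
- exact: (integrableZl measurable_D0 a (integrable_mker (k := 0) isT r1 SG)).
- exact: (integrableZl measurable_D0 b (integrable_mker (k := 1) isT r1 SG)).
Qed.

Lemma Rintegral_lin_mker (a b rho : R) : 1 <= rho ->
  \int[G]_(t in D0) (a * mker 0 rho t + b * mker 1 rho t) =
  a * moment G 0 rho + b * moment G 1 rho.
Proof.
move=> r1.
have I0 := integrable_mker (G := G) (k := 0) isT r1 SG.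
have I1 := integrable_mker (G := G) (k := 1) isT r1 SG.
rewrite RintegralD ?RintegralZl//.
- exact: (integrableZl measurable_D0 a I0).
- exact: (integrableZl measurable_D0 b I1).
Qed.

(** Reduces each lower bound on an exponent to a pointwise bound on the kernel, uniform in [t]. *)
Lemma Re_mul_ST_ge (u z : R[i]) (a b rho : R) : slit z -> 1 <= rho ->
  (forall t, 0 < t -> a * mker 0 rho t + b * mker 1 rho t <=
     complex.Re (u * (z + t%:C)^-1)) ->
  a * moment G 0 rho + b * moment G 1 rho <= complex.Re (u * ST G z).
Proof.
move=> /stieltjes_bounded_kernel[K bK] r1 H.
rewrite STE -(cintegralZ SG u bK) -Rintegral_lin_mker//.
have bu : stieltjes_bounded (fun t => u * (z + t%:C)^-1) (normc u * K).
  split; first by apply: cmeasurableM; [exact: cmeasurable_cst|case: bK].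
  by move=> t t0; rewrite normcM -mulrA ler_wpM2l ?normc_ge0//; exact: bK.2.
by apply: (Re_cintegral_ge SG bu) => //; exact: integrable_lin_mker.
Qed.

(* [z = rho e^(i theta)] with [cos theta = s >= - kappa]; then
   [|z + t|^2 >= (1 - kappa) (t^2 + rho^2)]. *)
Lemma normc_ST_le (z : R[i]) (s kappa rho : R) :
  1 <= rho -> 0 <= kappa < 1 -> - kappa <= s ->
  complex.Re z = rho * s -> complex.Re z ^+ 2 + complex.Im z ^+ 2 = rho ^+ 2 ->
  normc (ST G z) <=
    2 / (1 - kappa) * rho^-1 * (moment G 0 rho + moment G 1 rho).
Proof.
move=> r1 /andP[k0 k1] sk zs zr; have r0 : 0 < rho by exact: lt_le_trans r1.
have N0 t : 0 < t -> 0 < t ^+ 2 + rho ^+ 2.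
  by move=> t0; rewrite addr_gt0 ?exprn_gt0.
pose q := (1 - kappa)^-1 * rho^-1.
have q0 : 0 < q by rewrite mulr_gt0 ?invr_gt0// subr_gt0.
have DN t : 0 < t -> (1 - kappa) * (t ^+ 2 + rho ^+ 2) <=
    (complex.Re z + t) ^+ 2 + complex.Im z ^+ 2.
  move=> t0.
  have -> : (complex.Re z + t) ^+ 2 + complex.Im z ^+ 2 =
      t ^+ 2 + rho ^+ 2 + 2 * (t * rho) * s.
    by rewrite -zr zs; ring.
  have := ler_wpM2l (ltW (mulr_gt0 t0 r0)) sk.
  have := mulr_ge0 k0 (sqr_ge0 (t - rho)); lra.
(* If Im z = 0 then s^2 = 1, and s >= - kappa > -1 excludes the negative half-line. *)
have slz : slit z.
  rewrite /slit /=; have [y0|] := eqVneq (complex.Im z) 0; [right|by left].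
  move: zr; rewrite y0 expr0n addr0 zs exprMn -[RHS]mulr1.
  move=> /(mulfI (expf_neq0 2 (lt0r_neq0 r0))) s21; rewrite mulr_gt0//.
  by rewrite ltNge; apply/negP => s0; nra.
have [K bK] := stieltjes_bounded_kernel slz.
(* Both numerators, Re z + t and Im z, are at most rho + t in absolute value, so this sum dominates
   each component of the kernel; adding the two components gives the factor 2. *)
have mk t : 0 < t -> q * mker 0 rho t + q * mker 1 rho t =
    (rho + t) / ((1 - kappa) * (t ^+ 2 + rho ^+ 2)).
  move=> t0; rewrite /mker /q expr0 expr1 mul1r subn0 subSS; field.
  by rewrite !gt_eqF ?N0// subr_gt0.
have bnd (w t : R) : 0 < t -> `|w| <= rho + t ->
    `|w / ((complex.Re z + t) ^+ 2 + complex.Im z ^+ 2)| <=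
    q * mker 0 rho t + q * mker 1 rho t.
  move=> t0 wt; rewrite mk// normrM normfV.
  have N1 : 0 < (1 - kappa) * (t ^+ 2 + rho ^+ 2) by rewrite mulr_gt0 ?N0// subr_gt0.
  rewrite (ger0_norm (le_trans (ltW N1) (DN t t0))).
  apply: ler_pM; rewrite ?invr_ge0 ?(le_trans (ltW N1) (DN t t0))//.
  by rewrite lef_pV2 ?posrE ?(lt_le_trans N1 (DN t t0)) ?DN.
have Rez : `|complex.Re z| <= rho.
  by rewrite -(@ler_pXn2r _ 2) ?nnegrE ?(ltW r0)// real_normK ?num_real// -zr lerDl sqr_ge0.
have Imz : `|complex.Im z| <= rho.
  by rewrite -(@ler_pXn2r _ 2) ?nnegrE ?(ltW r0)// real_normK ?num_real// -zr lerDr sqr_ge0.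
have step (f : R -> R) : G.-integrable D0 (EFin \o f) ->
    (forall t, 0 < t -> `|f t| <= q * mker 0 rho t + q * mker 1 rho t) ->
    `|\int[G]_(t in D0) f t| <= q * moment G 0 rho + q * moment G 1 rho.
  move=> If Hf; apply: le_trans (le_normr_Rintegral measurable_D0 If) _.
  rewrite -Rintegral_lin_mker//; apply: le_Rintegral => //.
  - exact: integrable_norm If.
  - exact: integrable_lin_mker.
  - by move=> t /D0P; exact: Hf.
rewrite STE; apply: le_trans (normc_le_ReIm _) _ => /=.
apply: le_trans (lerD (step _ (stieltjes_bounded_Re SG bK) _)
  (step _ (stieltjes_bounded_Im SG bK) _)) _.
- move=> t t0; rewrite cReV cReD cImD /= addr0; apply: bnd => //.
  by apply: le_trans (ler_normD _ _) _; rewrite lerD// ger0_norm// ltW.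
- move=> t t0; rewrite cImV cReD cImD /= addr0 normrN; apply: bnd => //.
  by rewrite (le_trans Imz)// lerDl ltW.
by rewrite /q le_eqVlt; apply/orP; left; apply/eqP; field; rewrite !gt_eqF// subr_gt0.
Qed.

End Kernel.

(** * The kernel at a rotated point in polar form *)

Section Points.
Context {R : realType} (e : side).
Implicit Types (rho phi t : R).

Definition rot (z : R[i]) : R[i] := - (sg e)%:C * 'i * z.

Lemma sg_sqr : (sg e : R) ^+ 2 = 1.
Proof. by case: e; rewrite /= ?expr1n// sqrrN expr1n. Qed.

Lemma Re_rot z : complex.Re (rot z) = sg e * complex.Im z.
Proof. by rewrite /rot !ReImE /=; ring. Qed.

Lemma Im_rot z : complex.Im (rot z) = - sg e * complex.Re z.
Proof. by rewrite /rot !ReImE /=; ring. Qed.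

Lemma sqr_rot z : complex.Re (rot z) ^+ 2 + complex.Im (rot z) ^+ 2 =
  complex.Re z ^+ 2 + complex.Im z ^+ 2.
Proof. by rewrite Re_rot Im_rot mulNr sqrrN !exprMn sg_sqr !mul1r addrC. Qed.

Lemma sqr_polar rho phi :
  complex.Re (polar rho phi) ^+ 2 + complex.Im (polar rho phi) ^+ 2 = rho ^+ 2.
Proof. by rewrite /= !exprMn -mulrDr cos2Dsin2 mulr1. Qed.

Lemma normc_polar rho phi : 0 <= rho -> normc (polar rho phi) = rho.
Proof. by move=> r0; rewrite normcE sqr_polar sqrtr_sqr ger0_norm. Qed.

Lemma normc_rot z : normc (rot z) = normc z.
Proof. by rewrite !normcE sqr_rot. Qed.

Lemma sqr_lt1 (s : R) : `|s| <= 2^-1 -> s ^+ 2 < 1.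
Proof. by rewrite -(real_normK (num_real s)) => h; have := normr_ge0 s; nra. Qed.

Lemma slit_rot_polar rho phi : 0 < rho -> (sg e * sin phi) ^+ 2 < 1 ->
  slit (rot (polar rho phi)).
Proof.
move=> r0; rewrite exprMn sg_sqr mul1r -(cos2Dsin2 phi) ltrDr => c0.
have s0 : (sg e : R) != 0 by case: (e); rewrite /sg ?oppr_eq0 oner_eq0.
left; rewrite Im_rot /= mulNr oppr_eq0 !mulf_neq0 ?(gt_eqF r0)//.
by apply/eqP => c1; move: c0; rewrite c1 expr0n ltxx.
Qed.

(** The law of cosines: s = [sg e * sin phi] is the cosine of the argument of the rotated point. *)
Lemma rot_den rho phi t :
  (complex.Re (rot (polar rho phi)) + t) ^+ 2 + complex.Im (rot (polar rho phi)) ^+ 2 =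
  t ^+ 2 + rho ^+ 2 + 2 * (t * rho) * (sg e * sin phi).
Proof.
by rewrite -(sqr_polar rho phi) -sqr_rot sqrrD Re_rot /=; ring.
Qed.

Lemma Re_rot_kernel rho phi t :
  complex.Re (rot (polar rho phi) * (rot (polar rho phi) + t%:C)^-1) =
  (rho ^+ 2 + t * rho * (sg e * sin phi)) /
  (t ^+ 2 + rho ^+ 2 + 2 * (t * rho) * (sg e * sin phi)).
Proof.
rewrite -rot_den -(sqr_polar rho phi) -sqr_rot.
rewrite !(cReM, cReV, cImV, cReD, cImD) /= addr0 mulrN opprK !mulrA -mulrDl.
by congr (_ / _); ring.
Qed.

(** With zeta the rotated point, xi^2 = - zeta^2, so the numerator is - Re (zeta^2 (conj zeta + t))
    = - rho^3 s - t rho^2 (2 s^2 - 1). *)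
Lemma Re_sqr_kernel rho phi t :
  complex.Re (polar rho phi ^+ 2 * (rot (polar rho phi) + t%:C)^-1) =
  rho ^+ 2 * (t * (1 - 2 * (sg e * sin phi) ^+ 2) - rho * (sg e * sin phi)) /
  (t ^+ 2 + rho ^+ 2 + 2 * (t * rho) * (sg e * sin phi)).
Proof.
rewrite -rot_den !(cReM, cImM, cReV, cImV, cReD, cImD) addr0 mulrN opprK !mulrA -mulrDl.
congr (_ / _); rewrite /=.
transitivity (rho ^+ 2 * (t * (cos phi ^+ 2 - sin phi ^+ 2) -
   rho * sg e * sin phi * (cos phi ^+ 2 + sin phi ^+ 2))); first by ring.
transitivity (rho ^+ 2 * (t * (1 - 2 * (sg e ^+ 2 * sin phi ^+ 2)) -
  rho * sg e * sin phi)); last by ring.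
by rewrite cos2Dsin2 cos2sin2 sg_sqr; ring.
Qed.

(** The denominators [D] and [N] agree up to a factor 2, so replacing [D] by [N] halves the main
    part [P] at worst and doubles the error [B] at worst. *)
Lemma ratio_ge (A P B N D : R) : 0 < N -> N <= 2 * D -> D <= 2 * N ->
  0 <= P -> 0 <= B -> P - B <= A -> P / (2 * N) - 2 * B / N <= A / D.
Proof.
move=> N0 ND DN P0 B0 H; have D0 : 0 < D by lra.
apply: (@le_trans _ _ ((P - B) / D)); last by rewrite ler_pM2r ?invr_gt0.
rewrite mulrBl lerB//; first by rewrite ler_wpM2l// lef_pV2 ?posrE ?mulr_gt0.
by rewrite ler_pdivrMr// mulrAC ler_pdivlMr//; have := ler_wpM2l B0 ND; lra.
Qed.

(** Since 2 t rho <= N and |s| <= 1/2, the cross term is at most N / 2 in absolute value. *)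
Lemma den_bounds (rho s t : R) : 0 < rho -> 0 < t -> `|s| <= 2^-1 ->
  let N := t ^+ 2 + rho ^+ 2 in let D := N + 2 * (t * rho) * s in
  [/\ 0 < N, N <= 2 * D & D <= 2 * N].
Proof.
move=> r0 t0 s2 N D; rewrite /D {D}; move: s2; rewrite ler_norml => /andP[s1 s2].
have w0 : 0 < t * rho by rewrite mulr_gt0.
have N0 : 0 < N by rewrite addr_gt0 ?exprn_gt0.
have wN : 2 * (t * rho) <= N by rewrite /N; have := sqr_ge0 (t - rho); lra.
have := ler_wpM2l (ltW w0) s1; have := ler_wpM2l (ltW w0) s2.
by split => //; lra.
Qed.

(** In the numerator rho^2 is the main part and t rho |s| bounds the error. *)
Lemma rot_kernel_ge rho phi t : 0 < rho -> 0 < t -> `|sg e * sin phi| <= 2^-1 ->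
  2^-1 * mker 0 rho t + (- 2 * `|sg e * sin phi|) * mker 1 rho t <=
  complex.Re (rot (polar rho phi) * (rot (polar rho phi) + t%:C)^-1).
Proof.
move=> r0 t0 s2; rewrite Re_rot_kernel.
have [N0 ND DN] := den_bounds r0 t0 s2; have s0 := normr_ge0 (sg e * sin phi).
have H := @ratio_ge (rho ^+ 2 + t * rho * (sg e * sin phi)) (rho ^+ 2)
  (t * rho * `|sg e * sin phi|) _ _ N0 ND DN.
apply: le_trans (H _ _ _).
- rewrite /mker expr0 expr1 mul1r subn0 subSS subn0 expr1 le_eqVlt; apply/orP; left.
  by apply/eqP; field; rewrite gt_eqF.
- exact: sqr_ge0.
- by rewrite !mulr_ge0// ltW.
- rewrite lerD2l -mulrN ler_wpM2l//; first by rewrite mulr_ge0// ltW.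
  by rewrite lerNl -normrN ler_norm.
Qed.

(** Here t is the main part and rho |s| the error, both times rho^2; |s| <= 1/2 gives 1 - 2 s^2 >=
    1/2. *)
Lemma sqr_kernel_ge rho phi t : 0 < rho -> 0 < t -> `|sg e * sin phi| <= 2^-1 ->
  (- 2 * `|sg e * sin phi| * rho) * mker 0 rho t + (rho / 4) * mker 1 rho t <=
  complex.Re (polar rho phi ^+ 2 * (rot (polar rho phi) + t%:C)^-1).
Proof.
move=> r0 t0 s2; rewrite Re_sqr_kernel.
have [N0 ND DN] := den_bounds r0 t0 s2; set s := sg e * sin phi in s2 *.
have s0 := normr_ge0 s.
have H := @ratio_ge (rho ^+ 2 * (t * (1 - 2 * s ^+ 2) - rho * s)) (rho ^+ 2 * (t / 2))
  (rho ^+ 2 * (rho * `|s|)) _ _ N0 ND DN.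
apply: le_trans (H _ _ _).
- rewrite /mker expr0 expr1 mul1r subn0 subSS subn0 expr1 le_eqVlt; apply/orP; left.
  by apply/eqP; field; rewrite gt_eqF.
- by rewrite mulr_ge0 ?sqr_ge0// divr_ge0// ltW.
- by rewrite mulr_ge0 ?sqr_ge0// mulr_ge0// ltW.
- rewrite -mulrBr ler_wpM2l ?sqr_ge0//.
  have : rho * s <= rho * `|s| by rewrite ler_wpM2l ?ler_norm// ltW.
  have : s ^+ 2 <= 4^-1.
    by rewrite -real_normK ?num_real//; nra.
  move=> h; have := ler_wpM2l (ltW t0) h; lra.
Qed.

(** For s <= 0 both summands of the numerator are nonnegative and the denominator is at most t^2 +
    rho^2, so the summand - rho s alone gives the bound. The term with factor 0 fits the shape
    required by [Re_mul_ST_ge]. *)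
Lemma sqr_kernel_ge_neg rho phi t (s0 : R) : 0 < rho -> 0 < t -> 0 <= s0 ->
  sg e * sin phi <= - s0 -> (sg e * sin phi) ^+ 2 <= 2^-1 ->
  (s0 * rho) * mker 0 rho t + 0 * mker 1 rho t <=
  complex.Re (polar rho phi ^+ 2 * (rot (polar rho phi) + t%:C)^-1).
Proof.
move=> r0 t0 s00 hs s2; rewrite Re_sqr_kernel; set s := sg e * sin phi in hs s2 *.
have w0 : 0 < t * rho by rewrite mulr_gt0.
have N0 : 0 < t ^+ 2 + rho ^+ 2 by rewrite addr_gt0 ?exprn_gt0.
have wN : 2 * (t * rho) <= t ^+ 2 + rho ^+ 2 by have := sqr_ge0 (t - rho); lra.
have s1 : -1 < s by rewrite ltNge; apply/negP => h; nra.
have D0 : 0 < t ^+ 2 + rho ^+ 2 + 2 * (t * rho) * s.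
  have : 0 < (t * rho) * (1 + s) by rewrite mulr_gt0//; lra.
  lra.
have DN : t ^+ 2 + rho ^+ 2 + 2 * (t * rho) * s <= t ^+ 2 + rho ^+ 2.
  have : (t * rho) * s <= 0 by rewrite mulr_ge0_le0 ?(ltW w0)//; lra.
  lra.
rewrite mul0r addr0 /mker expr0 mul1r subn0 mulrA.
apply: ler_pM; rewrite ?invr_ge0 ?(ltW N0) ?mulr_ge0 ?sqr_ge0 ?(ltW r0)//.
  rewrite mulrC ler_wpM2l ?sqr_ge0//.
  have : rho * s <= rho * - s0 by rewrite ler_wpM2l// ltW.
  have : 0 <= t * (1 - 2 * s ^+ 2) by rewrite mulr_ge0 ?(ltW t0)//; lra.
  lra.
by rewrite lef_pV2 ?posrE.
Qed.

End Points.

(** * SINH-regularity *)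

Section Builder.
Context {R : realType}.
Implicit Types (e : side) (rho phi : R).

Lemma cosN_pi4 : cos (pi - pi / 4) = - cos (pi / 4) :> R.
Proof. by rewrite cosB cospi sinpi mul0r addr0 mulN1r. Qed.

Lemma pi4_bounds : 0 < pi / 4 :> R /\ pi / 4 < pi :> R.
Proof. by have := pi_gt0 R; split; lra. Qed.

Lemma cos_pi4_bounds : 0 <= cos (pi / 4 : R) < 1.
Proof.
have [p0 p1] := pi4_bounds; apply/andP; split.
  by apply: cos_ge0_pihalf; apply/andP; split; lra.
rewrite -[ltRHS]cos0 ltr_cos// in_itv/=; apply/andP; split => //; lra.
Qed.

(** The cones used have half-opening 3 pi / 4; this bound provides [kappa = cos (pi / 4)] for
    [normc_ST_le]. *)
Lemma cos_ge_arg (x : R) : `|x| < pi - pi / 4 -> - cos (pi / 4) <= cos x.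
Proof.
have [p0 p1] := pi4_bounds; move=> xg; rewrite -cosN_pi4 -(cos_norm x) ltW//.
rewrite ltr_cos// in_itv/=; apply/andP; split; rewrite ?normr_ge0//; lra.
Qed.

Lemma cos_sub_sg e phi : cos (phi - sg e * (pi / 2)) = sg e * sin phi.
Proof.
by case: e; rewrite /sg ?mul1r ?mulN1r ?opprK ?cosBpihalf ?cosDpihalf.
Qed.

(** Only real points of the cone are at stake: there |cos phi| = 1, and the lower bound - cos (pi /
    4) > -1 excludes a negative cosine. *)
Lemma slit_addr (y : R) (v : R[i]) : 0 < y ->
  (cone (pi - pi / 4) `|` [set 0]) v -> slit (y%:C + v).
Proof.
move=> y0 [[rho [phi [r0 hphi ->]]]|->]; last first.
  by right; rewrite cReD /= addr0.
have [s0|s0] := eqVneq (sin phi) 0; last first.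
  by left; rewrite cImD /= add0r mulf_neq0// gt_eqF.
right; rewrite cReD /=; have := sin0cos1 s0.
have : - cos (pi / 4) <= cos phi by apply: cos_ge_arg; rewrite ltr_norml.
have /andP[_ c1] := cos_pi4_bounds => h.
have [c0|c0] := leP 0 (cos phi).
  by move=> _; rewrite ltr_pwDl// mulr_ge0// ltW.
by rewrite ltr0_norm// => h'; move: h c1; lra.
Qed.

(** The rotation sends i y to [sg e * y], which is positive on the strip, and undoes the rotation of
    the cone. *)
Lemma slit_dom e (z : R[i]) : dom_set (OneSided e 0 (pi - pi / 4)) z -> slit (rot e z).
Proof.
move=> [y ys [w wc <-]].
have : exists2 v, (cone (pi - pi / 4) `|` [set 0]) v & w = (sg e)%:C * 'i * v.
  by case: wc => [[v vc <-]|->]; [exists v; [left|]|exists 0; [right|rewrite mulr0]].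
move=> [v vc ->].
have -> : rot e ('i * y%:C + (sg e)%:C * 'i * v) = (sg e * y)%:C + v.
  by rewrite /rot; case: e ys wc => _ _; case: v vc => v1 v2 _; apply/eqP;
    rewrite eq_complex /=; apply/andP; split; apply/eqP; ring.
apply: slit_addr vc; move: ys; case: e {wc} => /=; rewrite in_itv/= ?andbT ?mul1r//.
by move=> y0; rewrite mulN1r oppr_gt0.
Qed.

Section Process.
Context {d : measure_display} {Omega : measurableType d} {P : probability Omega R}.
Variables (X : R -> {RV P >-> R}) (psi : R -> R[i]) (Psi : R[i] -> R[i]) (e : side).
Hypotheses (hpsi : characteristic_exponent X psi)
  (psiE : forall xi, psi xi = Psi xi%:C)
  (dPsi : forall z, slit (rot e z) -> derivable (Psi : R[i]^o -> R[i]^o) z 1).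

(** Isolates what the four cases share. With half-opening 3 pi / 4 the cone of analyticity reaches
    only pi / 4 across the real axis on one side, hence the bounds on [gm] and [gp]. *)
Lemma SINH_regular_onesided (gm gp : R) (nu' nu : sinh_order) :
  order_ok nu' -> order_ok nu ->
  - (pi / 4) <= gm <= 0 -> 0 <= gp <= pi / 4 -> 0 < `|gm| + gp ->
  (exists C r : R, [/\ 0 < C, 0 < r & forall rho phi, r < rho ->
     - cos (pi / 4) <= sg e * sin phi ->
     normc (Psi (polar rho phi)) <= C * order_pow rho nu]) ->
  (forall a b, gm < a -> a <= b -> b < gp -> exists c r : R, [/\ 0 < c, 0 < r &
     forall rho phi, r < rho -> a <= phi <= b ->
       c * order_pow rho nu' <= complex.Re (Psi (polar rho phi))]) ->
  SINH_regular X (OneSided e 0 (pi - pi / 4)) gm gp nu' nu.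
Proof.
move=> ok' ok /andP[gm1 gm2] /andP[gp1 gp2] g0 up low.
have [p0 p1] := pi4_bounds; have pg := pi_gt0 R.
rewrite /SINH_regular /dom_args; split.
- by rewrite /dom_ok; case: (e); split => //; apply/andP; split; lra.
- by [].
- have gm3 : - (pi / 2) <= gm by lra.
  have gp3 : gp <= pi / 2 by lra.
  rewrite gm2 gm3 gp1 gp3; split => //; case: (e) => /=; lra.
(* The drift is chosen to be 0: any linear term stays inside [Psi]. *)
- exists psi, psi, 0, Psi; cbv zeta.
  have E z : - 'i * 0%:C * z + Psi z = Psi z by rewrite mulr0 mul0r add0r.
  split => //.
  + by move=> xi; rewrite mulr0 mul0r add0r.
  + split; first by move=> z /slit_dom; exact: dPsi.
    by move=> xi _; rewrite psiE.
  + move=> a b /andP[a1 _] /andP[_ b1]; have [C [r [C0 r0 H]]] := up.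
    exists C, r; split => // rho phi hr /andP[ha hb]; rewrite E complex_normE.
    apply: H => //; rewrite -cos_sub_sg; apply: cos_ge_arg.
    by rewrite ltr_norml; apply/andP; split; lra.
  + move=> a b ga ab bg; have [c [r [c0 r0 H]]] := low a b ga ab bg.
    by exists c, r; split => // rho phi hr hab; rewrite E; exact: H.
Qed.

End Process.

Lemma sin_small (eta : R) : 0 < eta -> exists delta : R,
  0 < delta <= pi / 4 /\ forall e phi, `|phi| < delta -> `|sg e * sin phi| <= eta.
Proof.
move=> eta0; have : sin x @[x --> (0 : R)] --> (0 : R).
  by rewrite -[X in _ --> X]sin0; exact: continuous_sin.
move=> /cvgr0Pnorm_le /(_ _ eta0) /nbhs_ballP[r /= r0 H].
have [p0 p1] := pi4_bounds.
exists (Num.min r (pi / 4)); split; first by rewrite lt_min r0 p0 ge_min lexx orbT.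
move=> e phi; rewrite lt_min => /andP[hr _]; rewrite normrM.
have -> : `|sg e : R| = 1 by case: e; rewrite /sg ?normrN normr1.
by rewrite mul1r; apply: H; rewrite /ball /= sub0r normrN.
Qed.

End Builder.

(** * The two exponents bounded by moments *)

Section Exponents.
Context {R : realType} (G : {measure set R -> \bar R}).
Hypothesis SG : (\int[G]_(t in `]0%R, +oo[) ((1 + t)^-1)%:E < +oo)%E.
Variable e : side.
Implicit Types (rho phi b : R).

(** The exponent of (a) and (b) at complex arguments; [lin_exponent] is that of (c) and (d). *)
Definition sqr_exponent b (z : R[i]) : R[i] :=
  z ^+ 2 * ST G (rot e z) - (sg e)%:C * 'i * b%:C * z.

Definition lin_exponent (z : R[i]) : R[i] := rot e z * ST G (rot e z).

Lemma derivable_lin_exponent z : slit (rot e z) ->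
  derivable (lin_exponent : R[i]^o -> R[i]^o) z 1.
Proof.
move=> /(derivable_ST_scale SG) dST.
have did : derivable (id : R[i]^o -> R[i]^o) z 1 by exact: derivable_id.
have dc (a : R[i]) : derivable (cst a : R[i]^o -> R[i]^o) z 1 by exact: derivable_cst.
exact: (derivableM (derivableM (dc (- (sg e)%:C * 'i)) did) dST).
Qed.

Lemma derivable_sqr_exponent b z : slit (rot e z) ->
  derivable (sqr_exponent b : R[i]^o -> R[i]^o) z 1.
Proof.
move=> /(derivable_ST_scale SG) dST.
have did : derivable (id : R[i]^o -> R[i]^o) z 1 by exact: derivable_id.
have dc (a : R[i]) : derivable (cst a : R[i]^o -> R[i]^o) z 1 by exact: derivable_cst.
exact: (derivableB (derivableM (derivableM did did) dST)
  (derivableM (dc ((sg e)%:C * 'i * b%:C)) did)).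
Qed.

Let q : R := 2 / (1 - cos (pi / 4)).

Lemma normc_ST_rot_le rho phi : 1 <= rho -> - cos (pi / 4) <= sg e * sin phi ->
  normc (ST G (rot e (polar rho phi))) <=
    q * rho^-1 * (moment G 0 rho + moment G 1 rho).
Proof.
move=> r1 hs; apply: (normc_ST_le SG r1 cos_pi4_bounds hs).
  by rewrite Re_rot /= mulrCA.
by rewrite sqr_rot sqr_polar.
Qed.

Lemma normc_lin_exponent_le rho phi : 1 <= rho -> - cos (pi / 4) <= sg e * sin phi ->
  normc (lin_exponent (polar rho phi)) <= q * (moment G 0 rho + moment G 1 rho).
Proof.
move=> r1 hs; have r0 : 0 < rho by exact: lt_le_trans r1.
rewrite normcM normc_rot normc_polar ?(ltW r0)//.
apply: le_trans (ler_wpM2l (ltW r0) (normc_ST_rot_le r1 hs)) _.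
by rewrite le_eqVlt; apply/orP; left; apply/eqP; field; rewrite gt_eqF.
Qed.

Lemma normc_sqr_exponent_le b rho phi : 1 <= rho -> - cos (pi / 4) <= sg e * sin phi ->
  normc (sqr_exponent b (polar rho phi)) <=
    rho * (q * (moment G 0 rho + moment G 1 rho) + `|b|).
Proof.
move=> r1 hs; have r0 : 0 < rho by exact: lt_le_trans r1.
rewrite /sqr_exponent; apply: le_trans (normc_leD _ _) _; rewrite mulrDr lerD//.
  rewrite normcM expr2 normcM normc_polar ?(ltW r0)// -mulrA.
  apply: ler_wpM2l; first exact: ltW.
  apply: le_trans (ler_wpM2l (ltW r0) (normc_ST_rot_le r1 hs)) _.
  by rewrite le_eqVlt; apply/orP; left; apply/eqP; field; rewrite gt_eqF.
rewrite normcN normcM normc_polar ?(ltW r0)// mulrC ler_wpM2l ?(ltW r0)//.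
rewrite -[X in X <= _]mul1r normcE !ReImE /= le_eqVlt; apply/orP; left; apply/eqP.
rewrite mul1r -sqrtr_sqr; congr Num.sqrt.
transitivity (sg e ^+ 2 * b ^+ 2); first by ring.
by rewrite sg_sqr mul1r.
Qed.

Lemma Re_drift_ge b rho phi : 0 <= rho ->
  - (rho * `|b|) <= complex.Re (- ((sg e)%:C * 'i * b%:C * polar rho phi)).
Proof.
move=> r0; rewrite !ReImE /=.
have -> : - ((((sg e * 0 - 0 * 1) * b - (sg e * 1 + 0 * 0) * 0) * (rho * cos phi)) -
   ((sg e * 0 - 0 * 1) * 0 + (sg e * 1 + 0 * 0) * b) * (rho * sin phi)) =
   rho * (sg e * (b * sin phi)) by ring.
rewrite -mulrN ler_wpM2l// lerNl; apply: le_trans (ler_norm _) _.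
rewrite normrN !normrM; have -> : `|sg e : R| = 1 by case: e; rewrite /sg ?normrN normr1.
by rewrite mul1r ler_piMr// sin_max.
Qed.

Lemma Re_lin_exponent_ge rho phi : 1 <= rho -> `|sg e * sin phi| <= 2^-1 ->
  2^-1 * moment G 0 rho - 2 * `|sg e * sin phi| * moment G 1 rho <=
  complex.Re (lin_exponent (polar rho phi)).
Proof.
move=> r1 hs; have r0 : 0 < rho by exact: lt_le_trans r1.
rewrite -mulNr -mulNr; apply: (Re_mul_ST_ge SG) => //; first exact: slit_rot_polar (sqr_lt1 hs).
by move=> t t0; exact: rot_kernel_ge.
Qed.

Lemma Re_sqr_exponent_ge b rho phi : 1 <= rho -> `|sg e * sin phi| <= 2^-1 ->
  rho * (4^-1 * moment G 1 rho - 2 * `|sg e * sin phi| * moment G 0 rho - `|b|) <=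
  complex.Re (sqr_exponent b (polar rho phi)).
Proof.
move=> r1 hs; have r0 : 0 < rho by exact: lt_le_trans r1.
have H := Re_mul_ST_ge SG (slit_rot_polar r0 (sqr_lt1 hs)) r1
  (fun t t0 => sqr_kernel_ge r0 t0 hs).
have := Re_drift_ge b phi (ltW r0); rewrite /sqr_exponent cReD; lra.
Qed.

Lemma Re_sqr_exponent_ge_neg b rho phi (s0 : R) : 1 <= rho -> 0 <= s0 ->
  sg e * sin phi <= - s0 -> (sg e * sin phi) ^+ 2 <= 2^-1 ->
  rho * (s0 * moment G 0 rho - `|b|) <= complex.Re (sqr_exponent b (polar rho phi)).
Proof.
move=> r1 s00 hs s2; have r0 : 0 < rho by exact: lt_le_trans r1.
have sl : slit (rot e (polar rho phi)) by apply: slit_rot_polar => //; lra.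
have H := Re_mul_ST_ge SG sl r1 (fun t t0 => sqr_kernel_ge_neg r0 t0 s00 hs s2).
have := Re_drift_ge b phi (ltW r0); rewrite /sqr_exponent cReD; lra.
Qed.

End Exponents.

(** * Growth of the exponents *)

Section Cases.
Context {R : realType} (G : {measure set R -> \bar R}).
Hypothesis SG : (\int[G]_(t in `]0%R, +oo[) ((1 + t)^-1)%:E < +oo)%E.
Variables (e : side) (b : R).
Context {d : measure_display} {Omega : measurableType d} {P : probability Omega R}.
Variables (X : R -> {RV P >-> R}) (psi : R -> R[i]).
Hypothesis hpsi : characteristic_exponent X psi.
Implicit Types (rho phi p : R).

Lemma powR_large p (M : R) : 0 < p ->
  exists2 r, 1 <= r & forall rho, r <= rho -> M <= rho `^ p.
Proof.
move=> p0; exists (Num.max 1 ((`|M| + 1) `^ p^-1)); first by rewrite le_max lexx.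
move=> rho; rewrite ge_max => /andP[r1 hr].
have M0 : 0 <= `|M| + 1 by rewrite addr_ge0.
apply: le_trans (_ : `|M| + 1 <= _); first by rewrite (le_trans (ler_norm M))// lerDl.
have E : ((`|M| + 1) `^ p^-1) `^ p = `|M| + 1.
  by rewrite -powRrM mulVf ?gt_eqF// powRr1.
by rewrite -[leLHS]E ge0_ler_powR ?nnegrE ?powR_ge0 ?(ltW p0) ?(le_trans ler01 r1).
Qed.

Lemma ln_large (M : R) : exists2 r : R, 1 <= r & forall rho, r <= rho -> M <= ln rho.
Proof.
exists (Num.max 1 (expR M)); first by rewrite le_max lexx.
move=> rho; rewrite ge_max => /andP[r1 hr].
by rewrite -[leLHS]expRK ler_ln ?posrE ?expR_gt0// (lt_le_trans (expR_gt0 M)).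
Qed.

Let q : R := 2 / (1 - cos (pi / 4)).

Let q0 : 0 < q.
Proof. by rewrite /q divr_gt0// subr_gt0; have /andP[] := @cos_pi4_bounds R. Qed.

Section PowerCase.
Variables (alpha c1 C1 r1 : R).
Hypotheses (ha : -1 < alpha < 0) (c10 : 0 < c1) (C10 : 0 < C1) (r11 : 1 <= r1).
Hypothesis HM : forall k rho, (k <= 1)%N -> r1 <= rho ->
  c1 * rho `^ (alpha + 1) <= moment G k rho <= C1 * rho `^ (alpha + 1).

Let M0 rho (h : r1 <= rho) := HM (leq0n 1) h.
Let M1 rho (h : r1 <= rho) := HM (leqnn 1) h.

(** The cone is so narrow that the error 2 |s| I_0 is at most half of the lower bound on the main
    term I_1 / 4; the same angle serves the linear exponent. *)
Let small_sin : exists delta : R, 0 < delta <= pi / 4 /\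
  forall phi, `|phi| < delta -> `|sg e * sin phi| <= 2^-1 /\
    2 * `|sg e * sin phi| * C1 <= c1 / 8.
Proof.
have eta0 : 0 < Num.min 2^-1 (c1 / (16 * C1)).
  by rewrite lt_min invr_gt0 ltr0n divr_gt0// mulr_gt0.
have [delta [d0 H]] := sin_small eta0; exists delta; split => // phi /(H e).
rewrite le_min => /andP[-> h]; split => //.
by move: h; rewrite ler_pdivlMr ?mulr_gt0//; lra.
Qed.

Lemma SINH_power_sqr : (forall xi, psi xi = sqr_exponent G e b xi%:C) ->
  exists m g gm gp : R, SINH_regular X (OneSided e m g) gm gp
    (Power (alpha + 2)) (Power (alpha + 2)) /\ gm < 0 < gp.
Proof.
move=> psiE; have [delta [/andP[d0 d1] small]] := small_sin.
have /andP[al1 al0] := ha.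
have ha1 : 0 < alpha + 1 by lra.
exists 0, (pi - pi / 4), (- delta), delta; split; last by rewrite oppr_lt0 d0.
have pE rho : 0 <= rho -> rho `^ (alpha + 2) = rho * rho `^ (alpha + 1).
  move=> r0; have -> : alpha + 1 = (alpha + 2) - 1 by lra.
  by rewrite mulr_powRB1//; lra.
(* Beyond [r2] the drift is absorbed: rho^(alpha + 1) >= 1 serves the upper bound, and |b| <= (c1 /
   16) rho^(alpha + 1) the lower one. *)
have [r2 r21 H2] := powR_large (Num.max 1 (16 * `|b| / c1)) ha1.
have big rho : Num.max r1 r2 < rho -> [/\ r1 <= rho, 1 <= rho, 0 < rho,
    1 <= rho `^ (alpha + 1) & 16 * `|b| <= c1 * rho `^ (alpha + 1)].
  rewrite gt_max => /andP[/ltW h1 /ltW h2].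
  have h3 : 1 <= rho by exact: le_trans h1.
  have := H2 _ h2; rewrite ge_max ler_pdivrMr// => /andP[h4 h5].
  by split => //; lra.
have rpos : 0 < Num.max r1 r2 by rewrite lt_max (lt_le_trans ltr01 r11).
refine (SINH_regular_onesided hpsi psiE
  (fun z => @derivable_sqr_exponent _ G SG e b z) _ _ _ _ _ _ _).
- by rewrite /= ; apply/andP; split; lra.
- by rewrite /= ; apply/andP; split; lra.
- by apply/andP; split; lra.
- by apply/andP; split; lra.
- by rewrite normrN gtr0_norm// addr_gt0.
- exists (2 * q * C1 + `|b|), (Num.max r1 r2); split => //.
    by rewrite ltr_wpDr// mulr_gt0// mulr_gt0.
  move=> rho phi /big[h1 h2 h3 h4 _] hs.
  apply: le_trans (normc_sqr_exponent_le SG b h2 hs) _.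
  rewrite /order_pow pE ?(ltW h3)// mulrCA ler_pM2l//.
  have /andP[_ m0] := M0 h1; have /andP[_ m1] := M1 h1.
  have := ler_wpM2l (ltW q0) (lerD m0 m1); have := ler_wpM2l (normr_ge0 b) h4.
  rewrite -/q; lra.
(* What remains of the main term is c1 / 4 - c1 / 8 - c1 / 16. *)
- move=> a' b' ga ab bg; exists (c1 / 16), (Num.max r1 r2); split => //.
    by rewrite divr_gt0.
  move=> rho phi /big[h1 h2 h3 h4 h5] /andP[ap pb].
  have [s1 s2] : `|sg e * sin phi| <= 2^-1 /\ 2 * `|sg e * sin phi| * C1 <= c1 / 8.
    by apply: small; rewrite ltr_norml; apply/andP; split; lra.
  apply: le_trans (Re_sqr_exponent_ge SG b h2 s1).
  rewrite /order_pow pE ?(ltW h3)// mulrCA ler_pM2l//.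
  have /andP[_ m0] := M0 h1; have /andP[m1 _] := M1 h1.
  have := ler_wpM2l (mulr_ge0 (ler0n _ 2) (normr_ge0 (sg e * sin phi))) m0.
  have := ler_wpM2r (powR_ge0 rho (alpha + 1)) s2.
  lra.
Qed.

Lemma SINH_power_lin : (forall xi, psi xi = lin_exponent G e xi%:C) ->
  exists m g gm gp : R, SINH_regular X (OneSided e m g) gm gp
    (Power (alpha + 1)) (Power (alpha + 1)) /\ gm < 0 < gp.
Proof.
move=> psiE; have [delta [/andP[d0 d1] small]] := small_sin.
have /andP[al1 al0] := ha.
exists 0, (pi - pi / 4), (- delta), delta; split; last by rewrite oppr_lt0 d0.
have rpos : 0 < r1 by exact: lt_le_trans r11.
refine (SINH_regular_onesided hpsi psiE
  (fun z => @derivable_lin_exponent _ G SG e z) _ _ _ _ _ _ _).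
- by rewrite /= ; apply/andP; split; lra.
- by rewrite /= ; apply/andP; split; lra.
- by apply/andP; split; lra.
- by apply/andP; split; lra.
- by rewrite normrN gtr0_norm// addr_gt0.
- exists (2 * q * C1), r1; split => //; first by rewrite mulr_gt0// mulr_gt0.
  move=> rho phi /ltW h1 hs; have h2 := le_trans r11 h1.
  apply: le_trans (normc_lin_exponent_le SG h2 hs) _.
  have /andP[_ m0] := M0 h1; have /andP[_ m1] := M1 h1.
  have := ler_wpM2l (ltW q0) (lerD m0 m1); rewrite /order_pow -/q; lra.
- move=> a' b' ga ab bg; exists (c1 / 4), r1; split => //.
    by rewrite divr_gt0.
  move=> rho phi /ltW h1 /andP[ap pb]; have h2 := le_trans r11 h1.
  have [s1 s2] : `|sg e * sin phi| <= 2^-1 /\ 2 * `|sg e * sin phi| * C1 <= c1 / 8.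
    by apply: small; rewrite ltr_norml; apply/andP; split; lra.
  apply: le_trans (Re_lin_exponent_ge SG h2 s1); rewrite /order_pow.
  have /andP[m0 _] := M0 h1; have /andP[_ m1] := M1 h1.
  have := ler_wpM2l (mulr_ge0 (ler0n _ 2) (normr_ge0 (sg e * sin phi))) m1.
  have := ler_wpM2r (powR_ge0 rho (alpha + 1)) s2.
  have := mulr_ge0 (ltW c10) (powR_ge0 rho (alpha + 1)).
  lra.
Qed.

End PowerCase.

Section LogCase.
Variables (c1 C1 r1 : R).
Hypotheses (c10 : 0 < c1) (C10 : 0 < C1) (r11 : 1 <= r1).
Hypothesis HM : forall rho, r1 <= rho ->
  [/\ c1 * ln rho <= moment G 0 rho, moment G 0 rho <= C1 * ln rho
    & moment G 1 rho <= C1].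

(** The sector of opening pi / 4 on the side of the real axis where s < 0. On compact subsectors s
    stays away from 0, and the opening keeps s^2 <= 1/2, as [sqr_kernel_ge_neg] requires. *)
Let neg_args : exists gm gp : R,
  [/\ - (pi / 4) <= gm <= 0 /\ 0 <= gp <= pi / 4, 0 < `|gm| + gp,
      (gm = 0 /\ 0 < gp) \/ (gm < 0 /\ gp = 0),
      double_cone gm gp `<=` [set z : R[i] | sg e * complex.Im z < 0]
    & forall a b', gm < a -> a <= b' -> b' < gp -> exists2 s0, 0 < s0 &
        forall phi, a <= phi <= b' ->
          sg e * sin phi <= - s0 /\ (sg e * sin phi) ^+ 2 <= 2^-1].
Proof.
have [p0 p1] := @pi4_bounds R; have pg := pi_gt0 R.
have half phi : - (pi / 4) <= phi <= pi / 4 -> sin phi ^+ 2 <= 2^-1.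
  move=> /andP[h1 h2]; have : 0 <= cos (phi *+ 2).
    by apply: cos_ge0_pihalf; apply/andP; split; lra.
  by rewrite cos_mulr2n cos2sin2; lra.
have sinlt (x y : R) : - (pi / 4) <= x -> x <= y -> y <= pi / 4 -> sin x <= sin y.
  move=> h1; rewrite le_eqVlt => /predU1P[->//|xy] h2; rewrite ltW// ltr_sin// in_itv/=.
    by apply/andP; split; lra.
  by apply/andP; split; lra.
have sinpos (x : R) : 0 < x -> x < pi -> 0 < sin x.
  by move=> x0 xp; apply: sin_gt0_pi; rewrite x0 xp.
(* Serves the component of the double cone around the negative real axis, whose arguments lie beyond
   pi. *)
have sinpi (x : R) : sin x = - sin (x - pi) by rewrite -[in LHS](subrK pi x) sinDpi.
case: e.
- exists (- (pi / 4)), 0; split => //.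
  + by split; apply/andP; split; lra.
  + by rewrite normrN gtr0_norm// addr0.
  + by right; split => //; lra.
  + move=> z [rho [phi [r0 hphi ->]]] /=; rewrite mul1r pmulr_rlt0//.
    case: hphi => /andP[h1 h2].
      by rewrite -oppr_gt0 -sinN sinpos; lra.
    by rewrite sinpi oppr_lt0 sinpos; lra.
  (* The endpoint nearest to the real axis gives the smallest |sin|. *)
  + move=> a b' ga ab b0; exists (sin (- b')); first by apply: sinpos; lra.
    move=> phi /andP[h1 h2]; rewrite sinN opprK /= !mul1r; split.
      by apply: sinlt; lra.
    by apply: half; apply/andP; split; lra.
- exists 0, (pi / 4); split => //.
  + by split; apply/andP; split; lra.
  + by rewrite normr0 add0r.
  + by left.
  + move=> z [rho [phi [r0 hphi ->]]] /=; rewrite mulN1r oppr_lt0 pmulr_rgt0//.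
    by case: hphi => /andP[h1 h2]; apply: sinpos; lra.
  + move=> a b' ga ab b0; exists (sin a); first by apply: sinpos; lra.
    move=> phi /andP[h1 h2]; rewrite /= mulN1r lerN2 sqrrN; split.
      by apply: sinlt; lra.
    by apply: half; apply/andP; split; lra.
Qed.

Lemma SINH_log_sqr : (forall xi, psi xi = sqr_exponent G e b xi%:C) ->
  exists m g gm gp : R,
    [/\ SINH_regular X (OneSided e m g) gm gp (Power 1) OnePlus,
        (gm = 0 /\ 0 < gp) \/ (gm < 0 /\ gp = 0)
      & double_cone gm gp `<=` [set z : R[i] | sg e * complex.Im z < 0]].
Proof.
move=> psiE; have [gm [gp [[g1 g2] g3 g4 g5 neg]]] := neg_args.
exists 0, (pi - pi / 4), gm, gp; split => //.
refine (SINH_regular_onesided hpsi psiE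
  (fun z => @derivable_sqr_exponent _ G SG e b z) _ _ _ _ _ _ _) => //.
- by rewrite /= ltr01 ler1n.
(* Once ln rho >= 1, the bounded I_1 and the drift are absorbed into multiples of ln rho. *)
- have [r2 r21 H2] := ln_large 1.
  exists (2 * q * C1 + `|b|), (Num.max r1 r2); split => //.
  + by rewrite ltr_wpDr// mulr_gt0// mulr_gt0.
  + by rewrite lt_max (lt_le_trans ltr01 r11).
  move=> rho phi; rewrite gt_max => /andP[/ltW h1 /ltW h2] hs.
  have h3 := le_trans r11 h1; have h4 := H2 _ h2.
  apply: le_trans (normc_sqr_exponent_le SG b h3 hs) _.
  rewrite /order_pow mulrCA ler_pM2l ?(lt_le_trans ltr01 h3)//.
  have [_ m0 m1] := HM h1; have := ler_wpM2l (ltW q0) (lerD m0 m1).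
  have := ler_wpM2l (normr_ge0 b) h4; have := ler_wpM2l (ltW (mulr_gt0 q0 C10)) h4.
  rewrite -/q; lra.
- move=> a b' ga ab bg; have [s0 s00 Hs] := neg a b' ga ab bg.
  (* Beyond [r2], s0 I_0 >= 1 + |b|, so the real part is at least rho. *)
  have [r2 r21 H2] := ln_large ((1 + `|b|) / (s0 * c1)).
  exists 1, (Num.max r1 r2); split => //.
    by rewrite lt_max (lt_le_trans ltr01 r11).
  move=> rho phi; rewrite gt_max => /andP[/ltW h1 /ltW h2] /Hs[s1 s2].
  have h3 := le_trans r11 h1; have := H2 _ h2; rewrite ler_pdivrMr ?mulr_gt0// => h4.
  apply: le_trans (Re_sqr_exponent_ge_neg SG b h3 (ltW s00) s1 s2).
  have rp := lt_le_trans ltr01 h3.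
  rewrite /order_pow powRr1 ?(ltW rp)// mulrC ler_pM2l//.
  have [m0 _ _] := HM h1; have := ler_wpM2l (ltW s00) m0; lra.
Qed.

Lemma SINH_log_lin : (forall xi, psi xi = lin_exponent G e xi%:C) ->
  exists m g gm gp : R,
    SINH_regular X (OneSided e m g) gm gp ZeroPlus ZeroPlus /\ gm < 0 < gp.
Proof.
move=> psiE; have half_gt0 : 0 < 2^-1 :> R by rewrite invr_gt0.
have [delta [/andP[d0 d1] small]] := sin_small half_gt0.
exists 0, (pi - pi / 4), (- delta), delta; split; last by rewrite oppr_lt0 d0.
refine (SINH_regular_onesided hpsi psiE
  (fun z => @derivable_lin_exponent _ G SG e z) _ _ _ _ _ _ _) => //.
- by apply/andP; split; lra.
- by apply/andP; split; lra.
- by rewrite normrN gtr0_norm// addr_gt0.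
- have [r2 r21 H2] := ln_large 1.
  exists (2 * q * C1), (Num.max r1 r2); split => //.
  + by rewrite mulr_gt0// mulr_gt0.
  + by rewrite lt_max (lt_le_trans ltr01 r11).
  move=> rho phi; rewrite gt_max => /andP[/ltW h1 /ltW h2] hs.
  have h3 := le_trans r11 h1; have h4 := H2 _ h2.
  apply: le_trans (normc_lin_exponent_le SG h3 hs) _; rewrite /order_pow.
  have [_ m0 m1] := HM h1; have := ler_wpM2l (ltW q0) (lerD m0 m1).
  have := ler_wpM2l (ltW (mulr_gt0 q0 C10)) h4.
  rewrite -/q; lra.
(* Since 2 |s| <= 1, the error is at most I_1 <= C1, and beyond [r2] this is at most (c1 / 4) ln
   rho, half of the lower bound on I_0 / 2. *)
- move=> a b' ga ab bg; have [r2 r21 H2] := ln_large (4 * C1 / c1).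
  exists (c1 / 4), (Num.max r1 r2); split => //.
  + by rewrite divr_gt0.
  + by rewrite lt_max (lt_le_trans ltr01 r11).
  move=> rho phi; rewrite gt_max => /andP[/ltW h1 /ltW h2] /andP[ap pb].
  have h3 := le_trans r11 h1; have := H2 _ h2; rewrite ler_pdivrMr// => h4.
  have s1 : `|sg e * sin phi| <= 2^-1.
    by apply: small; rewrite ltr_norml; apply/andP; split; lra.
  apply: le_trans (Re_lin_exponent_ge SG h3 s1); rewrite /order_pow.
  have [m0 _ m1] := HM h1.
  have s2 : 2 * `|sg e * sin phi| <= 1 by lra.
  have := ler_wpM2r (moment_ge0 G 1 (le_trans ler01 h3)) s2.
  lra.
Qed.

End LogCase.
End Cases.

Theorem theorem3p37 (R : realType) (mu : R) (G : {measure set R -> \bar R})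
    (alpha C c rho0 : R)
    (hmu : 0 <= mu) (hG : SM mu G) (halpha : -1 <= alpha < 0)
    (hC : 0 < C) (hc : 0 < c) (hrho0 : 1 <= rho0)
    (hbound : forall (k : nat) (rho : R), (k <= 1)%N -> rho0 <= rho ->
      ((c * rho `^ (alpha + 1))%:E *
         \int[lebesgue_measure]_(t in `[(mu / rho)%R, +oo[)
            (t `^ (k%:R + alpha) / (t ^+ 2 + 1))%:E
       <= \int[rescale rho G]_(t in `[(mu / rho)%R, +oo[)
            (t ^+ k / (t ^+ 2 + 1))%:E
       <= (C * rho `^ (alpha + 1))%:E *
         \int[lebesgue_measure]_(t in `[(mu / rho)%R, +oo[)
            (t `^ (k%:R + alpha) / (t ^+ 2 + 1))%:E)%E)
    (e : side) (b : R)
    (d : measure_display) (Omega : measurableType d) (P : probability Omega R)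
    (X : R -> {RV P >-> R}) (psi : R -> R[i])
    (hX : levy_process X) (hside : spectrally e X)
    (hpsi : characteristic_exponent X psi) :
  [/\ (* (a) *)
      (forall xi : R, psi xi =
         xi%:C ^+ 2 * ST G (- (sg e)%:C * 'i * xi%:C)
         - (sg e)%:C * 'i * b%:C * xi%:C) ->
      -1 < alpha ->
      exists m g gm gp : R,
        SINH_regular X (OneSided e m g) gm gp
          (Power (alpha + 2)) (Power (alpha + 2))
        /\ gm < 0 < gp,
      (* (b) *)
      (forall xi : R, psi xi =
         xi%:C ^+ 2 * ST G (- (sg e)%:C * 'i * xi%:C)
         - (sg e)%:C * 'i * b%:C * xi%:C) ->
      alpha = -1 ->
      exists m g gm gp : R,
        [/\ SINH_regular X (OneSided e m g) gm gp (Power 1) OnePlus,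
            (gm = 0 /\ 0 < gp) \/ (gm < 0 /\ gp = 0)
          & double_cone gm gp `<=` [set z : R[i] | sg e * complex.Im z < 0]],
      (* (c) *)
      (forall xi : R, psi xi =
         - (sg e)%:C * 'i * xi%:C * ST G (- (sg e)%:C * 'i * xi%:C)) ->
      -1 < alpha ->
      exists m g gm gp : R,
        SINH_regular X (OneSided e m g) gm gp
          (Power (alpha + 1)) (Power (alpha + 1))
        /\ gm < 0 < gp
    & (* (d) *)
      (forall xi : R, psi xi =
         - (sg e)%:C * 'i * xi%:C * ST G (- (sg e)%:C * 'i * xi%:C)) ->
      alpha = -1 ->
      exists m g gm gp : R,
        SINH_regular X (OneSided e m g) gm gp ZeroPlus ZeroPlus
        /\ gm < 0 < gp].
Proof.
(* The four formulas for [psi] are [sqr_exponent] and [lin_exponent] at real points up to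
   unfolding. *)
case: (hG) => _ _ SG; have /andP[a1 a0] := halpha; split => psiE ha.
- have [|c1 [C1 [r [c10 C10 r1 H]]]] := moment_power hmu hG hC hc hrho0 hbound.
    by rewrite ha.
  by apply: (SINH_power_sqr SG hpsi _ c10 C10 r1 H psiE); rewrite ha.
- have [c1 [C1 [r [c10 C10 r1 H]]]] := moment_log hmu hG hC hc hrho0 hbound ha.
  exact: (SINH_log_sqr SG hpsi c10 C10 r1 H psiE).
- have [|c1 [C1 [r [c10 C10 r1 H]]]] := moment_power hmu hG hC hc hrho0 hbound.
    by rewrite ha.
  by apply: (SINH_power_lin SG hpsi _ c10 C10 r1 H psiE); rewrite ha.
- have [c1 [C1 [r [c10 C10 r1 H]]]] := moment_log hmu hG hC hc hrho0 hbound ha.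
  exact: (SINH_log_lin SG hpsi c10 C10 r1 H psiE).
Qed.
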